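(* Let $T>0$, $\omega=\frac{2\pi}{T}$, $p>0$, $c\in\mathbb{R}$, and let $b$ be a constant with $0<b<\omega^2$. Let $a,e\in C(\mathbb{R})$ be $T$-periodic, with $a(t)>0$ for all $t$ and $\int_0^T e(t)\,dt=0$. For $\mu\in\mathbb{R}$ consider the problem $$u''(t)+c\,u'(t)+b\,u(t)+\frac{a(t)}{u^p(t)}=\mu+e(t),\qquad u(t+T)=u(t).\qquad ( * )$$ Then there is a $\mu_0>0$ such that $( * )$ has exactly two, exactly one, or zero positive $T$-periodic solutions depending on whether $\mu>\mu_0$, $\mu=\mu_0$, or $\mu<\mu_0$, respectively. Moreover, write each positive $T$-periodic solution as $u(t)=\xi+U(t)$ with $\xi\in\mathbb{R}$ and $\int_0^T U(t)\,dt=0$. Then $\xi$ is a global parameter: the value of $\xi$ uniquely identifies the solution pair $(u(t),\mu)$. All positive $T$-periodic solutions of $( * )$ lie on a unique parabola-like curve $\mu=\varphi(\xi)$ (that is, the set of pairs $(\xi,\mu)$ arising from positive $T$-periodic solutions of $( * )$ is the graph of $\varphi$), where $\varphi$ is defined for $\xi\in(\bar\xi,\infty)$ with some $\bar\xi\ge 0$, and $$\lim_{\xi\to\bar\xi}\varphi(\xi)=\infty,\qquad \lim_{\xi\to\infty}\varphi(\xi)=\infty .$$ In case $a(t)$ is a constant, $\bar\xi=0$.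
   Context: A positive $T$-periodic solution is a $T$-periodic $u\in C^2(\mathbb{R})$ with $u(t)>0$ for all $t$ satisfying the equation for all $t$. A solution pair is $(u,\mu)$ with $\mu\in\mathbb{R}$ and $u$ a positive $T$-periodic solution of $( * )$ for that $\mu$. The number $\xi=\frac1T\int_0^T u(t)\,dt$ is the average of $u$. ''Parabola-like'' means that $\varphi$ is continuous and is decreasing up to a single point and increasing after it (that point being its global minimum). *)

(* Defs.v *)
From Stdlib Require Import Reals.
From Coquelicot Require Import Coquelicot.
Open Scope R_scope.

Definition C2 (u : R -> R) : Prop :=
  (forall t, ex_derive_n u 1 t) /\
  (forall t, ex_derive_n u 2 t) /\
  (forall t, continuous (Derive_n u 2) t).

Definition periodic (T : R) (f : R -> R) : Prop := forall t, f (t + T) = f t.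

(* [Rpower x p] is the real power x^p only for x > 0; the positivity of u
   makes the singular term below meaningful. *)
Definition positive_periodic_solution
    (T p c b : R) (a e : R -> R) (mu : R) (u : R -> R) : Prop :=
  C2 u /\
  periodic T u /\
  (forall t, 0 < u t) /\
  (forall t, Derive_n u 2 t + c * Derive u t + b * u t + a t / Rpower (u t) p
             = mu + e t).

(* In the decomposition u = xi + U with U of zero mean over a period,
   xi is the average of u. *)
Definition average (T : R) (u : R -> R) : R := / T * RInt u 0 T.

Definition exactly_two {X : Type} (P : X -> Prop) : Prop :=
  exists x y, x <> y /\ forall z, P z <-> z = x \/ z = y.

Definition exactly_one {X : Type} (P : X -> Prop) : Prop := exists! x, P x.

Definition none {X : Type} (P : X -> Prop) : Prop := forall x, ~ P x.

(* Only the values of phi on the open half-line (xibar, +oo) matter. *)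
Definition parabola_like (xibar : R) (phi : R -> R) : Prop :=
  (forall xi, xibar < xi -> continuous phi xi) /\
  exists xi0, xibar < xi0 /\
    (forall x y, xibar < x -> x < y -> y <= xi0 -> phi y < phi x) /\
    (forall x y, xi0 <= x -> x < y -> phi x < phi y) /\
    (forall x, xibar < x -> phi xi0 <= phi x).

(* The pairs (average of u, mu) given by the solution pairs (u, mu) form exactly
   the graph of phi over (xibar, +oo), and phi is parabola-like there. *)
Definition parabola_like_solution_curve
    (T p c b : R) (a e : R -> R) (xibar : R) (phi : R -> R) : Prop :=
  0 <= xibar /\
  parabola_like xibar phi /\
  (forall xi mu,
    (exists u, positive_periodic_solution T p c b a e mu u /\ average T u = xi)
    <-> (xibar < xi /\ mu = phi xi)).

(* Main.v *)
Require Import Defs.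
From Stdlib Require Import ZArith Reals Lra Lia FunctionalExtensionality.
From Stdlib Require Import Classical IndefiniteDescription Ranalysis5.
From Coquelicot Require Import Coquelicot.
Open Scope R_scope.

(** Write a solution as u = xi + U with U of mean zero, and fix lam with
    b < lam^2 < omega^2.  Everything rests on the Wirtinger inequality
    lam^2 int U^2 <= int U'^2 and on x^(-p) being positive, decreasing, strictly
    convex and unbounded near 0.

    Prescribed average.  Multiplying the equation by U and integrating over a period
    makes the damping term disappear, and b < lam^2 leaves a coercive form
    ([energy_coercive]).  As x^(-p) is decreasing, the problem for U at fixed xi is
    strongly monotone, hence has at most one solution ([solution_unique]).  For existence
    the singularity is first frozen below a level d; the resulting Lipschitz monotone
    problem is solved by a relaxed fixed point iteration that contracts the norm
    (int U'^2)^(1/2) and so converges uniformly ([contraction], [lipschitz_existence]).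

    The frozen solution solves the true problem once d is small, because of bounds that
    depend only on xi ([apriori]): monotonicity allows x^(-p) to be replaced by xi^(-p) in
    the energy estimate, which bounds U; at a maximum of u, where u >= xi and u'' <= 0,
    the equation bounds mu from above; at a minimum, where u'' >= 0, it bounds u^(-p)
    from above, so u stays away from 0.  Thus every xi > 0 is the average of exactly one
    solution and mu = phi(xi) is defined on all of (0, oo).  The same extremum arguments
    give phi -> oo at 0 ([solution_mu_bounds]), integrating the equation gives
    phi(xi) > b xi, and the energy estimate for differences gives continuity
    ([mu_continuous]).

    Shape of the curve.  Two solutions with the same mu are strictly ordered: their
    difference solves a linear equation with coefficient below omega^2, so it cannot have
    two zeros at distance at most T/2 ([sign_trichotomy]).  Three ordered solutions are
    excluded by strict convexity, which makes e^(ct) times the Wronskian of the two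
    successive differences strictly increasing, whereas it vanishes at s and s + T when s
    is a critical point of their periodic quotient ([at_most_two_solutions]).  So phi is
    a continuous function on (0, oo), infinite at both ends and taking each value at most
    twice; such a function decreases and then increases
    ([parabola_like_of_two_to_one]), which yields the exact count of solutions. *)

(** * Continuity, derivatives and integrals of real functions *)

Definition C0 (f : R -> R) : Prop := forall t, continuous f t.

Lemma C0_const (k : R) : C0 (fun _ => k).
Proof. intro t; apply continuous_const. Qed.

Lemma C0_id : C0 (fun t => t).
Proof. intro t; apply continuous_id. Qed.

Lemma C0_plus (f g : R -> R) : C0 f -> C0 g -> C0 (fun t => f t + g t).
Proof. intros hf hg t; exact (continuous_plus f g t (hf t) (hg t)). Qed.

Lemma C0_minus (f g : R -> R) : C0 f -> C0 g -> C0 (fun t => f t - g t).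
Proof. intros hf hg t; exact (continuous_minus f g t (hf t) (hg t)). Qed.

Lemma C0_opp (f : R -> R) : C0 f -> C0 (fun t => - f t).
Proof. intros hf t; exact (continuous_opp f t (hf t)). Qed.

Lemma C0_mult (f g : R -> R) : C0 f -> C0 g -> C0 (fun t => f t * g t).
Proof. intros hf hg t; exact (continuous_mult f g t (hf t) (hg t)). Qed.

Lemma C0_comp (f g : R -> R) : C0 f -> C0 g -> C0 (fun t => g (f t)).
Proof. intros hf hg t; exact (continuous_comp f g t (hf t) (hg (f t))). Qed.

Lemma C0_abs (f : R -> R) : C0 f -> C0 (fun t => Rabs (f t)).
Proof. intros hf t; apply (continuous_comp f Rabs); [apply hf | apply continuous_Rabs]. Qed.

Lemma C0_derivable (f df : R -> R) : (forall t, is_derive f t (df t)) -> C0 f.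
Proof. intros h t; apply (ex_derive_continuous f); exists (df t); apply h. Qed.

#[export] Hint Resolve C0_const C0_id C0_plus C0_minus C0_opp C0_mult C0_abs : c0.

Ltac c0 := solve [auto 20 with c0].

Lemma is_derive_eq (f : R -> R) (t l l' : R) : is_derive f t l -> l = l' -> is_derive f t l'.
Proof. intros h <-; exact h. Qed.

Lemma derive_const (k t : R) : is_derive (fun _ => k) t 0.
Proof. exact (is_derive_const k t). Qed.

Lemma derive_id (t : R) : is_derive (fun x => x) t 1.
Proof. exact (is_derive_id t). Qed.

Lemma derive_plus (f g : R -> R) (t k l : R) :
  is_derive f t k -> is_derive g t l -> is_derive (fun x => f x + g x) t (k + l).
Proof. exact (is_derive_plus f g t k l). Qed.

Lemma derive_minus (f g : R -> R) (t k l : R) :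
  is_derive f t k -> is_derive g t l -> is_derive (fun x => f x - g x) t (k - l).
Proof. exact (is_derive_minus f g t k l). Qed.

Lemma derive_opp (f : R -> R) (t k : R) :
  is_derive f t k -> is_derive (fun x => - f x) t (- k).
Proof. exact (is_derive_opp f t k). Qed.

Lemma derive_mult (f g : R -> R) (t k l : R) :
  is_derive f t k -> is_derive g t l -> is_derive (fun x => f x * g x) t (k * g t + f t * l).
Proof. intros hf hg; apply (is_derive_mult f g t k l hf hg); exact Rmult_comm. Qed.

Lemma derive_shift (f : R -> R) (t s k : R) :
  is_derive f (t + s) k -> is_derive (fun x => f (x + s)) t k.
Proof.
intro h; apply (is_derive_eq _ _ (scal 1 k)); [|exact (Rmult_1_l k)].
apply (is_derive_comp f (fun x => x + s)); [exact h|].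
apply (is_derive_eq _ _ (1 + 0)); [|ring].
apply derive_plus; [apply derive_id | apply derive_const].
Qed.

(* Hypotheses are matched up to syntax: comparing two functions up to conversion
   would unfold integrals. *)
Ltac der_step :=
  match goal with
  | h : forall _, is_derive ?f _ _ |- is_derive ?g _ _ => constr_eq f g; apply h
  | h : is_derive ?f _ _ |- is_derive ?g _ _ => constr_eq f g; exact h
  | |- is_derive (fun _ => ?k) _ _ => apply (derive_const k)
  | |- is_derive (fun x => x) _ _ => apply derive_id
  | |- is_derive (fun x => ?f x) ?t ?l => change (is_derive f t l)
  | |- is_derive (fun x => @?f x + @?g x) _ _ => eapply (derive_plus f g)
  | |- is_derive (fun x => @?f x - @?g x) _ _ => eapply (derive_minus f g)
  | |- is_derive (fun x => - @?f x) _ _ => eapply (derive_opp f)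
  | |- is_derive (fun x => @?f x * @?g x) _ _ => eapply (derive_mult f g)
  | |- is_derive (fun x => ?f (x + ?s)) _ _ => eapply (derive_shift f)
  end.
Ltac der := eapply is_derive_eq; [repeat der_step | cbv beta; try ring].

Lemma C0_continuity (f : R -> R) : C0 f -> continuity f.
Proof. intros hf t; apply continuity_pt_filterlim, hf. Qed.

Lemma C0_ex_RInt (f : R -> R) (x y : R) : C0 f -> ex_RInt f x y.
Proof. intro hf; apply (ex_RInt_continuous f); intros; apply hf. Qed.

Lemma C0_is_RInt (f : R -> R) (x y : R) : C0 f -> is_RInt f x y (RInt f x y).
Proof. intro hf; apply (RInt_correct f), C0_ex_RInt, hf. Qed.

(** The codomain of [RInt] is the carrier of a complete normed module; fixing it to be
    syntactically R lets ring, field and lra recognise equations between integrals. *)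
Definition integral (f : R -> R) (x y : R) : R := RInt f x y.

Lemma int_point (f : R -> R) (x : R) : integral f x x = 0.
Proof. exact (RInt_point x f). Qed.

Lemma int_lin (f g : R -> R) (k l x y : R) : C0 f -> C0 g ->
  integral (fun t => k * f t + l * g t) x y = k * integral f x y + l * integral g x y.
Proof.
intros hf hg; apply is_RInt_unique.
apply (is_RInt_plus (fun t => k * f t) (fun t => l * g t));
  [apply (is_RInt_scal f) | apply (is_RInt_scal g)]; apply C0_is_RInt; assumption.
Qed.

Lemma int_plus (f g : R -> R) (x y : R) : C0 f -> C0 g ->
  integral (fun t => f t + g t) x y = integral f x y + integral g x y.
Proof. intros hf hg; apply (RInt_plus f g); apply C0_ex_RInt; assumption. Qed.

Lemma int_minus (f g : R -> R) (x y : R) : C0 f -> C0 g ->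
  integral (fun t => f t - g t) x y = integral f x y - integral g x y.
Proof. intros hf hg; apply (RInt_minus f g); apply C0_ex_RInt; assumption. Qed.

Lemma int_scal (f : R -> R) (k x y : R) : C0 f ->
  integral (fun t => k * f t) x y = k * integral f x y.
Proof. intro hf; apply (RInt_scal f); apply C0_ex_RInt; assumption. Qed.

Lemma int_const (k x y : R) : integral (fun _ => k) x y = (y - x) * k.
Proof. exact (RInt_const x y k). Qed.

Lemma int_ext (f g : R -> R) (x y : R) : (forall t, f t = g t) -> integral f x y = integral g x y.
Proof. intro h; apply RInt_ext; intros; apply h. Qed.

Lemma int_le (f g : R -> R) (x y : R) : x <= y -> C0 f -> C0 g ->
  (forall t, f t <= g t) -> integral f x y <= integral g x y.
Proof. intros hxy hf hg h; apply RInt_le; auto using C0_ex_RInt. Qed.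

Lemma int_ge0 (f : R -> R) (x y : R) : x <= y -> C0 f ->
  (forall t, 0 <= f t) -> 0 <= integral f x y.
Proof. intros hxy hf h; apply RInt_ge_0; auto using C0_ex_RInt. Qed.

Lemma int_chasles (f : R -> R) (x y z : R) : C0 f ->
  integral f x y + integral f y z = integral f x z.
Proof. intro hf; apply (RInt_Chasles f); apply C0_ex_RInt; assumption. Qed.

Lemma int_derive (F f : R -> R) (x y : R) :
  (forall t, is_derive F t (f t)) -> C0 f -> integral f x y = F y - F x.
Proof.
intros hF hf; apply is_RInt_unique.
apply (is_RInt_derive F f); intros; [apply hF | apply hf].
Qed.

Lemma primitive_derive (f : R -> R) (x t : R) : C0 f -> is_derive (integral f x) t (f t).
Proof.
intro hf; apply (is_derive_RInt f (integral f x) x t); [|apply hf].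
apply filter_forall; intro y; apply C0_is_RInt, hf.
Qed.

(** * The Wirtinger inequality on an interval *)

Lemma increasing_of_derive (F f : R -> R) (x y : R) : x <= y ->
  (forall t, x <= t <= y -> is_derive F t (f t)) ->
  (forall t, x <= t <= y -> 0 <= f t) -> F x <= F y.
Proof.
intros hxy hF hf.
destruct (MVT_gen F x y f) as [z [hz e]].
- rewrite Rmin_left, Rmax_right by assumption; intros; apply hF; lra.
- rewrite Rmin_left, Rmax_right by assumption; intros t ht.
  apply continuity_pt_filterlim, (ex_derive_continuous F); exists (f t); apply hF; lra.
- rewrite Rmin_left, Rmax_right in hz by assumption.
  specialize (hf z hz); nra.
Qed.

Lemma derive_tan (lam m t : R) : cos (lam * (t - m)) <> 0 ->
  is_derive (fun t => sin (lam * (t - m)) / cos (lam * (t - m))) t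
    (lam * (1 + (sin (lam * (t - m)) / cos (lam * (t - m))) * (sin (lam * (t - m)) / cos (lam * (t - m))))).
Proof.
intro hc; auto_derive; [exact hc|].
change (t + - m) with (t - m); field; exact hc.
Qed.

(** With v(t) = lam tan(lam (t - m)), m the midpoint, one has the identity
    f'^2 - lam^2 f^2 = (f' + v f)^2 - (v f^2)', and v is finite on [x, y] exactly because
    lam (y - x) < PI; the boundary terms vanish with f.  Instead of integrating the tangent,
    the proof shows that a primitive of the left side plus v f^2 is nondecreasing. *)
Lemma dirichlet_inequality (lam x y : R) (f df : R -> R) :
  0 < lam -> x <= y -> lam * (y - x) < PI ->
  (forall t, is_derive f t (df t)) -> C0 df ->
  f x = 0 -> f y = 0 ->
  lam * lam * integral (fun t => f t * f t) x y <= integral (fun t => df t * df t) x y.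
Proof.
intros hlam hxy hlen hf hdf fx fy.
pose proof (C0_derivable _ _ hf) as cf.
set (q := fun t => df t * df t - lam * lam * (f t * f t)).
assert (cq : C0 q) by (unfold q; c0).
set (m := (x + y) / 2).
set (F := fun t => integral q x t + lam * (f t * f t) * (sin (lam * (t - m)) / cos (lam * (t - m)))).
set (r := fun t => df t + lam * (sin (lam * (t - m)) / cos (lam * (t - m))) * f t).
assert (h : F x <= F y).
{ apply (increasing_of_derive F (fun t => r t * r t)); auto.
  2: intros; nra.
  intros t ht.
  assert (hc : 0 < cos (lam * (t - m))).
  { apply cos_gt_0; unfold m; nra. }
  eapply is_derive_eq.
  - apply derive_plus; [apply primitive_derive, cq|].
    apply derive_mult; [|apply derive_tan; lra].
    repeat der_step.
  - cbv beta; unfold r, q; ring. }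
unfold F in h.
rewrite int_point, fx, fy in h.
assert (h2 : 0 <= integral q x y) by lra.
unfold q in h2.
rewrite int_minus, int_scal in h2 by c0. lra.
Qed.

(** * Periodic functions *)

Lemma per_const (T k : R) : periodic T (fun _ => k).
Proof. intro t; reflexivity. Qed.

Lemma per_plus (T : R) (f g : R -> R) :
  periodic T f -> periodic T g -> periodic T (fun t => f t + g t).
Proof. intros hf hg t; rewrite hf, hg; reflexivity. Qed.

Lemma per_minus (T : R) (f g : R -> R) :
  periodic T f -> periodic T g -> periodic T (fun t => f t - g t).
Proof. intros hf hg t; rewrite hf, hg; reflexivity. Qed.

Lemma per_opp (T : R) (f : R -> R) : periodic T f -> periodic T (fun t => - f t).
Proof. intros hf t; rewrite hf; reflexivity. Qed.

Lemma per_mult (T : R) (f g : R -> R) :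
  periodic T f -> periodic T g -> periodic T (fun t => f t * g t).
Proof. intros hf hg t; rewrite hf, hg; reflexivity. Qed.

Lemma per_comp (T : R) (f g : R -> R) : periodic T f -> periodic T (fun t => g (f t)).
Proof. intros hf t; rewrite hf; reflexivity. Qed.

Lemma per_derive (T : R) (f df : R -> R) :
  (forall t, is_derive f t (df t)) -> periodic T f -> periodic T df.
Proof.
intros hf pf t.
rewrite <- (is_derive_unique _ _ _ (hf t)); symmetry; apply is_derive_unique.
apply (is_derive_ext (fun s => f (s + T))); [exact pf|].
der.
Qed.

#[export] Hint Resolve per_const per_plus per_minus per_opp per_mult per_comp : per.

Ltac per := solve [auto 20 with per].

Lemma periodic_Z (T : R) (f : R -> R) (n : Z) (t : R) :
  periodic T f -> f (t + IZR n * T) = f t.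
Proof.
intro pf.
assert (pos : forall (k : nat) s, f (s + INR k * T) = f s).
{ induction k as [|k IH]; intro s.
  - simpl; f_equal; ring.
  - rewrite S_INR. replace (s + (INR k + 1) * T) with ((s + INR k * T) + T) by ring.
    rewrite pf; apply IH. }
destruct (Z_le_gt_dec 0 n) as [h|h].
- rewrite <- (Z2Nat.id n h), <- INR_IZR_INZ; apply pos.
- rewrite <- (pos (Z.to_nat (- n)) (t + IZR n * T)).
  rewrite INR_IZR_INZ, Z2Nat.id, opp_IZR by lia; f_equal; ring.
Qed.

Lemma periodic_reduce (T t : R) : 0 < T ->
  exists n s, 0 <= s <= T /\ t = s + IZR n * T.
Proof.
intro hT.
destruct (archimed (t / T)) as [h1 h2].
exists (up (t / T) - 1)%Z, (t - IZR (up (t / T) - 1) * T).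
rewrite minus_IZR.
assert (e : t = t / T * T) by (field; lra).
set (q := t / T) in *; set (k := IZR (up q)) in *.
split; [|ring]. rewrite e. split; nra.
Qed.

Lemma periodic_max (T : R) (f : R -> R) : 0 < T -> C0 f -> periodic T f ->
  exists s, forall t, f t <= f s.
Proof.
intros hT hf pf.
destruct (continuity_ab_maj f 0 T) as [s [hs _]].
- lra.
- intros; apply C0_continuity, hf.
- exists s; intro t; destruct (periodic_reduce T t hT) as [n [r [hr ->]]].
  rewrite periodic_Z by assumption; apply hs, hr.
Qed.

Lemma periodic_min (T : R) (f : R -> R) : 0 < T -> C0 f -> periodic T f ->
  exists s, forall t, f s <= f t.
Proof.
intros hT hf pf.
destruct (periodic_max T (fun t => - f t) hT) as [s hs]; [c0|per|].
exists s; intro t; specialize (hs t); lra.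
Qed.

(** * The Wirtinger inequality over a period *)

(** Both sides agree at s = 0, and the derivative in s is f (s + T) - f s = 0. *)
Lemma int_shift (T s : R) (f : R -> R) : C0 f -> periodic T f ->
  integral f s (s + T) = integral f 0 T.
Proof.
intros hf pf.
assert (h : integral (fun _ => 0) 0 s =
  (integral f 0 (s + T) - integral f 0 s) - (integral f 0 (0 + T) - integral f 0 0)).
{ apply (int_derive (fun r => integral f 0 (r + T) - integral f 0 r)); [|c0].
  intro t.
  pose proof (fun x => primitive_derive f 0 x hf) as h1.
  generalize dependent (integral f 0); intros Q h1.
  der. rewrite pf; ring. }
rewrite int_const, int_point in h.
replace (0 + T) with T in h by ring.
pose proof (int_chasles f 0 s (s + T) hf). lra.
Qed.

Lemma int_periodic_derive (T : R) (F f : R -> R) :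
  (forall t, is_derive F t (f t)) -> C0 f -> periodic T F -> integral f 0 T = 0.
Proof.
intros hF hf pF; rewrite (int_derive F) by assumption.
pose proof (pF 0) as h; rewrite Rplus_0_l in h; lra.
Qed.

(** Hurwitz's trick: by the intermediate value theorem W takes the same value at s and at
    s + T/2 for some s.  Subtracting this value, which only increases int W^2 as W has mean
    zero, gives a function vanishing at s, s + T/2 and s + T, to which the Dirichlet
    inequality applies on both halves. *)
Lemma poincare (T lam : R) (W dW : R -> R) :
  0 < T -> 0 < lam -> lam * T < 2 * PI ->
  (forall t, is_derive W t (dW t)) -> C0 dW -> periodic T W -> integral W 0 T = 0 ->
  lam * lam * integral (fun t => W t * W t) 0 T <= integral (fun t => dW t * dW t) 0 T.
Proof.
intros hT hlam hlT hW cdW pW mW.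
pose proof (C0_derivable _ _ hW) as cW.
pose proof (per_derive _ _ _ hW pW) as pdW.
assert (hs : exists s, W s = W (s + T / 2)).
{ destruct (IVT_gen (fun t => W (t + T / 2) - W t) 0 (T / 2) 0) as [s [_ hs]].
  - apply C0_continuity, C0_minus; [|assumption].
    apply (C0_comp (fun t => t + T / 2)); c0.
  - replace (T / 2 + T / 2) with (0 + T) by field. rewrite pW.
    replace (0 + T / 2) with (T / 2) by ring.
    unfold Rmin, Rmax; destruct Rle_dec; lra.
  - exists s; lra. }
destruct hs as [s hs].
set (f := fun t => W t - W s).
assert (hf : forall t, is_derive f t (dW t)).
{ intro t; unfold f; der. }
assert (cf : C0 f) by (unfold f; c0).
assert (h1 := dirichlet_inequality lam s (s + T / 2) f dW).
assert (h2 := dirichlet_inequality lam (s + T / 2) (s + T) f dW).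
assert (e : f (s + T / 2) = 0) by (unfold f; lra).
assert (e' : f (s + T) = 0) by (unfold f; rewrite pW; lra).
assert (e'' : f s = 0) by (unfold f; lra).
specialize (h1 hlam ltac:(lra) ltac:(nra) hf cdW e'' e).
specialize (h2 hlam ltac:(lra) ltac:(nra) hf cdW e e').
pose proof (int_chasles (fun t => f t * f t) s (s + T / 2) (s + T) ltac:(c0)) as i1.
pose proof (int_chasles (fun t => dW t * dW t) s (s + T / 2) (s + T) ltac:(c0)) as i2.
rewrite (int_shift T) in i1; [|c0|unfold f; per].
rewrite (int_shift T) in i2; [|c0|per].
assert (i3 : integral (fun t => f t * f t) 0 T =
  integral (fun t => W t * W t) 0 T + T * (W s * W s)).
{ rewrite (int_ext (fun t => f t * f t) (fun t => 1 * (W t * W t) + 1 * ((-2 * W s) * W t + W s * W s * 1)))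
    by (intro; unfold f; ring).
  rewrite int_lin by c0. rewrite int_lin by c0. rewrite int_const, mW; ring. }
assert (0 <= T * (W s * W s)) by nra.
assert (0 <= lam * lam * (T * (W s * W s))) by nra.
nra.
Qed.

(** The mean value theorem for the primitive of W, which is 0 at both ends of the period. *)
Lemma mean_zero_vanishes (T : R) (W : R -> R) : 0 < T -> C0 W -> integral W 0 T = 0 ->
  exists s, W s = 0.
Proof.
intros hT cW mW.
destruct (MVT_gen (integral W 0) 0 T W) as [s [_ hs]].
- intros; apply primitive_derive, cW.
- intros; apply continuity_pt_filterlim, (ex_derive_continuous (integral W 0)).
  eexists; apply primitive_derive, cW.
- exists s. rewrite int_point, mW in hs; nra.
Qed.

(** From a zero of W at most one period to the left, W^2 grows at rate
    2 W W' <= W^2 + W'^2, whose integral over a period the Wirtinger inequality controls. *)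
Lemma sup_bound (T lam : R) (W dW : R -> R) (t : R) :
  0 < T -> 0 < lam -> lam * T < 2 * PI ->
  (forall t, is_derive W t (dW t)) -> C0 dW -> periodic T W -> integral W 0 T = 0 ->
  W t * W t <= (1 + / (lam * lam)) * integral (fun t => dW t * dW t) 0 T.
Proof.
intros hT hlam hlT hW cdW pW mW.
pose proof (C0_derivable _ _ hW) as cW.
pose proof (per_derive _ _ _ hW pW) as pdW.
destruct (mean_zero_vanishes T W hT cW mW) as [s0 hs0].
assert (hs : exists s, W s = 0 /\ s <= t <= s + T).
{ destruct (periodic_reduce T (t - s0) hT) as [n [r [hr hn]]].
  exists (s0 + IZR n * T); rewrite periodic_Z by assumption.
  split; [assumption|]; lra. }
destruct hs as [s [hs hst]].
set (q := fun t => W t * W t + dW t * dW t).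
assert (cq : C0 q) by (unfold q; c0).
assert (h : W t * W t <= integral q s t).
{ replace (W t * W t) with (integral (fun t => 2 * (W t * dW t)) s t).
  - apply int_le; [lra|c0|c0|]. intro x; unfold q; pose proof (Rle_0_sqr (W x - dW x)) as hx; unfold Rsqr in hx; lra.
  - rewrite (int_derive (fun t => W t * W t)); [rewrite hs; ring| |c0].
    intro x; der. }
assert (h' : integral q s t <= integral q s (s + T)).
{ rewrite <- (int_chasles q s t (s + T) cq).
  assert (0 <= integral q t (s + T)); [|lra].
  apply int_ge0; [lra|assumption|]. intro; unfold q; nra. }
rewrite (int_shift T) in h'; [|assumption|unfold q; per].
unfold q in h'; rewrite (int_plus (fun t => W t * W t) (fun t => dW t * dW t) 0 T) in h' by c0.
pose proof (poincare T lam W dW hT hlam hlT hW cdW pW mW) as hp.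
assert (hl : 0 < lam * lam) by nra.
assert (integral (fun t => W t * W t) 0 T <= / (lam * lam) * integral (fun t => dW t * dW t) 0 T).
{ apply (Rmult_le_reg_l (lam * lam)); [assumption|].
  rewrite <- Rmult_assoc, Rinv_r by lra. lra. }
unfold q in h; lra.
Qed.

(** * The energy estimate *)

Lemma int_square (f : R -> R) (T : R) : 0 <= T -> C0 f -> 0 <= integral (fun t => f t * f t) 0 T.
Proof. intros hT hf; apply int_ge0; [assumption|c0|intro; apply Rle_0_sqr]. Qed.

(** The integral over a period of W times the equation: W'' W gives - int W'^2, while
    c W' W and k W integrate to 0. *)
Lemma energy (T c b k : R) (W H D Delta : R -> R) :
  (forall t, is_derive W t (H t)) -> (forall t, is_derive H t (D t)) ->
  C0 Delta -> periodic T W -> integral W 0 T = 0 ->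
  (forall t, D t + c * H t + b * W t + Delta t = k) ->
  integral (fun t => H t * H t) 0 T =
    b * integral (fun t => W t * W t) 0 T + integral (fun t => Delta t * W t) 0 T.
Proof.
intros hW hH cDelta pW mW heq.
pose proof (C0_derivable _ _ hW) as cW.
pose proof (C0_derivable _ _ hH) as cH.
pose proof (per_derive _ _ _ hW pW) as pH.
assert (h : integral (fun t => (1 * (H t * H t) + -b * (W t * W t)) + (-1 * (Delta t * W t) + k * W t)) 0 T = 0).
{ apply (int_periodic_derive T (fun t => W t * H t + c / 2 * (W t * W t))); [|c0|per].
  intro t; der. replace (D t) with (k - Delta t - b * W t - c * H t) by (rewrite <- (heq t); ring).
  field. }
rewrite int_plus in h by c0.
rewrite int_lin, int_lin, mW in h by c0. lra.
Qed.

(** The estimate on which uniqueness, existence, the a priori bounds and continuity all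
    depend; Delta is the difference of the nonlinear terms, possibly with forcing. *)
Lemma energy_coercive (T lam c b k : R) (W H D Delta : R -> R) :
  0 < T -> 0 < lam -> lam * T < 2 * PI -> 0 < b ->
  (forall t, is_derive W t (H t)) -> (forall t, is_derive H t (D t)) ->
  C0 Delta -> periodic T W -> integral W 0 T = 0 ->
  (forall t, D t + c * H t + b * W t + Delta t = k) ->
  (1 - b / (lam * lam)) * integral (fun t => H t * H t) 0 T
    <= integral (fun t => Delta t * W t) 0 T.
Proof.
intros hT hlam hlT hb hW hH cDelta pW mW heq.
pose proof (energy T c b k W H D Delta hW hH cDelta pW mW heq) as h1.
pose proof (poincare T lam W H hT hlam hlT hW (C0_derivable _ _ hH) pW mW) as h2.
assert (hl : 0 < lam * lam) by nra.
set (I := integral (fun t => H t * H t) 0 T) in *.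
set (I0 := integral (fun t => W t * W t) 0 T) in *.
assert (b * I0 <= b / (lam * lam) * I).
{ apply (Rmult_le_reg_l (lam * lam)); [assumption|].
  replace (lam * lam * (b / (lam * lam) * I)) with (b * I) by (field; lra). nra. }
lra.
Qed.

(** * Mean-zero primitives *)

Definition center (T : R) (f : R -> R) (t : R) : R := f t - / T * integral f 0 T.

Definition mean_zero_primitive (T : R) (f : R -> R) : R -> R :=
  center T (integral (center T f) 0).

Lemma center_C0 (T : R) (f : R -> R) : C0 f -> C0 (center T f).
Proof. intro hf; unfold center; c0. Qed.

Lemma center_per (T : R) (f : R -> R) : periodic T f -> periodic T (center T f).
Proof. intro hf; unfold center; per. Qed.

Lemma center_mean (T : R) (f : R -> R) : 0 < T -> C0 f -> integral (center T f) 0 T = 0.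
Proof.
intros hT hf; unfold center. rewrite int_minus, int_const by c0. field; lra.
Qed.

Lemma center_id (T : R) (f : R -> R) (t : R) : integral f 0 T = 0 -> center T f t = f t.
Proof. intro h; unfold center; rewrite h; ring. Qed.

Lemma primitive_C0 (f : R -> R) (x : R) : C0 f -> C0 (integral f x).
Proof. intro hf; apply (C0_derivable _ f); intro; apply primitive_derive, hf. Qed.

Lemma mean_zero_primitive_derive (T : R) (f : R -> R) : C0 f ->
  forall t, is_derive (mean_zero_primitive T f) t (center T f t).
Proof.
intros hf t. pose proof (primitive_derive _ 0 t (center_C0 T f hf)) as h.
unfold mean_zero_primitive; unfold center at 1. der.
Qed.

Lemma mean_zero_primitive_C0 (T : R) (f : R -> R) : C0 f -> C0 (mean_zero_primitive T f).
Proof. intro hf; apply center_C0, primitive_C0, center_C0, hf. Qed.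

Lemma mean_zero_primitive_per (T : R) (f : R -> R) : 0 < T -> C0 f -> periodic T f ->
  periodic T (mean_zero_primitive T f).
Proof.
intros hT hf pf; apply center_per; intro t.
pose proof (center_C0 T f hf) as hc.
rewrite <- (int_chasles _ 0 t (t + T) hc), int_shift by (assumption || apply center_per, pf).
rewrite center_mean by assumption; ring.
Qed.

Lemma mean_zero_primitive_mean (T : R) (f : R -> R) : 0 < T -> C0 f ->
  integral (mean_zero_primitive T f) 0 T = 0.
Proof. intros hT hf; apply center_mean; [assumption|]. apply primitive_C0, center_C0, hf. Qed.

Lemma center_minus (T : R) (f g : R -> R) (t : R) : C0 f -> C0 g ->
  center T (fun s => f s - g s) t = center T f t - center T g t.
Proof. intros hf hg; unfold center; rewrite int_minus by assumption; ring. Qed.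

Lemma mean_zero_primitive_minus (T : R) (f g : R -> R) (t : R) : C0 f -> C0 g ->
  mean_zero_primitive T (fun s => f s - g s) t
    = mean_zero_primitive T f t - mean_zero_primitive T g t.
Proof.
intros hf hg; unfold mean_zero_primitive.
pose proof (center_C0 T f hf) as cf; pose proof (center_C0 T g hg) as cg.
rewrite <- center_minus by (apply primitive_C0; assumption).
f_equal; apply functional_extensionality; intro s.
rewrite <- int_minus by assumption.
apply int_ext; intro; apply center_minus; assumption.
Qed.

(** Centering is the orthogonal projection on mean-zero functions. *)
Lemma center_square (T : R) (f : R -> R) : 0 < T -> C0 f ->
  integral (fun t => center T f t * center T f t) 0 T <= integral (fun t => f t * f t) 0 T.
Proof.
intros hT hf.
set (M := / T * integral f 0 T).
assert (e : integral f 0 T = T * M) by (unfold M; field; lra).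
rewrite (int_ext (fun t => center T f t * center T f t)
  (fun t => 1 * (f t * f t) + 1 * ((-2 * M) * f t + M * M * 1)))
  by (intro; unfold center; fold M; ring).
rewrite int_lin by c0. rewrite int_lin by c0. rewrite int_const, e.
assert (0 <= T * (M * M)) by nra. nra.
Qed.

Lemma mean_zero_primitive_square (T lam : R) (f : R -> R) :
  0 < T -> 0 < lam -> lam * T < 2 * PI -> C0 f -> periodic T f ->
  lam * lam * integral (fun t => mean_zero_primitive T f t * mean_zero_primitive T f t) 0 T
    <= integral (fun t => f t * f t) 0 T.
Proof.
intros hT hlam hlT hf pf.
eapply Rle_trans; [|apply center_square; assumption].
apply poincare; auto using mean_zero_primitive_derive, center_C0, mean_zero_primitive_per, mean_zero_primitive_mean.
Qed.

Lemma mean_zero_primitive_sup (T lam M : R) (f : R -> R) (t : R) :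
  0 < T -> 0 < lam -> lam * T < 2 * PI -> C0 f -> periodic T f -> 0 <= M ->
  (forall s, Rabs (f s) <= M) ->
  Rabs (mean_zero_primitive T f t) <= sqrt ((1 + / (lam * lam)) * T) * M.
Proof.
intros hT hlam hlT hf pf hM hfM.
assert (hl : 0 < / (lam * lam)) by (apply Rinv_0_lt_compat; nra).
rewrite <- (sqrt_Rsqr M) at 1 by assumption.
rewrite <- sqrt_mult_alt by nra.
rewrite <- sqrt_Rsqr_abs. apply sqrt_le_1_alt. unfold Rsqr.
eapply Rle_trans.
- apply (sup_bound T lam _ (center T f)); auto using mean_zero_primitive_derive, center_C0, mean_zero_primitive_per, mean_zero_primitive_mean.
- rewrite Rmult_assoc. apply Rmult_le_compat_l; [lra|].
  eapply Rle_trans; [apply center_square; assumption|].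
  replace (T * (M * M)) with (integral (fun _ => M * M) 0 T) by (rewrite int_const; ring).
  apply int_le; [lra|c0|c0|]. intro s. specialize (hfM s).
  apply Rabs_le_between in hfM; nra.
Qed.

(** Zarantonello's argument.  The map U - tau (U + K (c U' + b U + gamma - e)), where K
    inverts the second derivative on mean-zero functions, is the relaxed iteration for the
    periodic problem.  Here W is the difference of two iterates, Delta that of their
    nonlinear terms, and V the derivative of the difference of the images.  For the inner
    product int W'1 W'2 the operator is strongly monotone with constant
    m = 1 - b / lam^2 (the damping is skew, Delta W <= 0) and Lipschitz with constant
    C^(1/2), so tau = m / C gives the factor q = 1 - m^2 / C. *)
Lemma contraction (T lam c b K : R) :
  0 < T -> 0 < lam -> lam * T < 2 * PI -> 0 < b < lam * lam -> 0 <= K ->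
  exists tau q, 0 < tau /\ 0 <= q < 1 /\
  forall W H Delta : R -> R,
    (forall t, is_derive W t (H t)) -> C0 H -> periodic T W -> integral W 0 T = 0 ->
    C0 Delta -> periodic T Delta ->
    (forall t, Delta t * W t <= 0) ->
    (forall t, Rabs (Delta t) <= K * Rabs (W t)) ->
    forall V : R -> R,
    (forall t, V t = H t - tau * (H t + c * W t + b * mean_zero_primitive T W t
                                  + mean_zero_primitive T Delta t)) ->
    integral (fun t => V t * V t) 0 T <= q * integral (fun t => H t * H t) 0 T.
Proof.
intros hT hlam hlT hb hK.
set (L := / (lam * lam)).
assert (hL : 0 < L) by (apply Rinv_0_lt_compat; nra).
assert (hLl : L * (lam * lam) = 1) by (unfold L; field; nra).
assert (hdiv : forall X Z, lam * lam * X <= Z -> X <= L * Z).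
{ intros X Z h. replace X with (L * (lam * lam * X)) by (rewrite <- Rmult_assoc, hLl; ring).
  apply Rmult_le_compat_l; lra. }
set (m := 1 - b * L).
assert (hm : 0 < m <= 1) by (unfold m; split; nra).
(* C dominates the squared Lipschitz constant: the factor 4 comes from squaring a sum of
   four terms, and each further power of L from one use of the Wirtinger inequality. *)
set (C := 4 * (1 + c * c * L + b * b * L * L + K * K * L * L)).
assert (hC : 4 <= C).
{ unfold C. pose proof (Rle_0_sqr c) as h1. pose proof (Rle_0_sqr (b * L)) as h2.
  pose proof (Rle_0_sqr (K * L)) as h3. unfold Rsqr in *.
  assert (0 <= c * c * L) by nra. nra. }
exists (m / C), (1 - m * m / C).
assert (hq : 0 <= m * m / C <= / 4).
{ split.
  - apply Rmult_le_pos; [nra|]. left; apply Rinv_0_lt_compat; lra.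
  - apply (Rmult_le_reg_r C); [lra|]. unfold Rdiv; rewrite Rmult_assoc, Rinv_l by lra. nra. }
assert (hq' : 0 < m * m / C).
{ apply Rmult_lt_0_compat; [nra|]. apply Rinv_0_lt_compat; lra. }
assert (ht : 0 < m / C).
{ apply Rmult_lt_0_compat; [lra|]. apply Rinv_0_lt_compat; lra. }
split; [assumption|]. split; [lra|].
intros W H Delta hW cH pW mW cD pD hDW hDK V hV.
pose proof (C0_derivable _ _ hW) as cW.
set (J := mean_zero_primitive T W). set (JD := mean_zero_primitive T Delta).
fold J JD in hV.
assert (cJ : C0 J) by (apply mean_zero_primitive_C0; assumption).
assert (cJD : C0 JD) by (apply mean_zero_primitive_C0; assumption).
assert (pJ : periodic T J) by (apply mean_zero_primitive_per; assumption).
assert (pJD : periodic T JD) by (apply mean_zero_primitive_per; assumption).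
assert (hJ : forall t, is_derive J t (W t)).
{ intro t; eapply is_derive_eq; [apply mean_zero_primitive_derive, cW|]. apply center_id, mW. }
assert (hJD : forall t, is_derive JD t (center T Delta t)) by (intro t; apply mean_zero_primitive_derive, cD).
pose proof (center_C0 T Delta cD) as cPD.
set (Y := fun t => H t + c * W t + b * J t + JD t).
assert (cY : C0 Y) by (unfold Y; c0).
set (I := integral (fun t => H t * H t) 0 T).
assert (iW : integral (fun t => W t * W t) 0 T <= L * I).
{ apply hdiv, poincare; assumption. }
assert (hI : 0 <= I) by (apply int_square; [lra|assumption]).
assert (hI0 : 0 <= integral (fun t => W t * W t) 0 T) by (apply int_square; [lra|assumption]).
assert (iJ : integral (fun t => J t * J t) 0 T <= L * L * I).
{ rewrite Rmult_assoc; eapply Rle_trans; [apply hdiv, mean_zero_primitive_square; assumption|].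
  apply Rmult_le_compat_l; lra. }
assert (iD : integral (fun t => Delta t * Delta t) 0 T <= K * K * integral (fun t => W t * W t) 0 T).
{ rewrite <- int_scal by c0. apply int_le; [lra|c0|c0|]. intro t.
  specialize (hDK t). pose proof (Rabs_pos (Delta t)). pose proof (Rabs_pos (W t)).
  pose proof (Rsqr_abs (Delta t)) as h1; pose proof (Rsqr_abs (W t)) as h2; unfold Rsqr in h1, h2.
  rewrite h1, h2. nra. }
assert (iJD : integral (fun t => JD t * JD t) 0 T <= K * K * L * L * I).
{ eapply Rle_trans; [apply hdiv, mean_zero_primitive_square; assumption|].
  assert (K * K * integral (fun t => W t * W t) 0 T <= K * K * (L * I)) by nra.
  replace (K * K * L * L * I) with (L * (K * K * (L * I))) by ring.
  apply Rmult_le_compat_l; lra. }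
assert (iY : integral (fun t => Y t * Y t) 0 T <= C * I).
{ eapply Rle_trans.
  - apply (int_le _ (fun t => 4 * ((1 * (H t * H t) + c * c * (W t * W t))
        + (b * b * (J t * J t) + 1 * (JD t * JD t))))); [lra|c0|c0|].
    intro t; unfold Y.
    pose proof (Rle_0_sqr (H t - c * W t)) as h1; pose proof (Rle_0_sqr (H t - b * J t)) as h2.
    pose proof (Rle_0_sqr (H t - JD t)) as h3; pose proof (Rle_0_sqr (c * W t - b * J t)) as h4.
    pose proof (Rle_0_sqr (c * W t - JD t)) as h5; pose proof (Rle_0_sqr (b * J t - JD t)) as h6.
    unfold Rsqr in *. nra.
  - rewrite int_scal by c0. rewrite int_plus by c0. rewrite !int_lin by c0.
    fold I. unfold C.
    pose proof (Rle_0_sqr c) as h1; pose proof (Rle_0_sqr b) as h2; unfold Rsqr in *. nra. }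
assert (iHY : m * I <= integral (fun t => H t * Y t) 0 T).
{ assert (h1 : integral (fun t => H t * W t + W t * H t) 0 T = 0).
  { apply (int_periodic_derive T (fun t => W t * W t)); [|c0|per]. intro; der. }
  assert (h2 : integral (fun t => 1 * (H t * J t) + 1 * (W t * W t)) 0 T = 0).
  { apply (int_periodic_derive T (fun t => W t * J t)); [|c0|per]. intro; der. }
  set (M := / T * integral Delta 0 T).
  assert (h3 : integral (fun t => 1 * (H t * JD t) + 1 * (1 * (Delta t * W t) + - M * W t)) 0 T = 0).
  { apply (int_periodic_derive T (fun t => W t * JD t)); [|c0|per]. intro; der.
    unfold center; fold M; ring. }
  assert (h4 : integral (fun t => Delta t * W t) 0 T <= 0).
  { replace 0 with (integral (fun _ => 0) 0 T) at 2 by (rewrite int_const; ring).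
    apply int_le; [lra|c0|c0|assumption]. }
  rewrite int_lin in h2 by c0.
  rewrite int_lin in h3 by c0. rewrite int_lin, mW in h3 by c0.
  rewrite (int_ext (fun t => H t * Y t) (fun t => (1 * (H t * H t) + c / 2 * (H t * W t + W t * H t))
      + (b * (H t * J t) + 1 * (H t * JD t)))) by (intro; unfold Y; field).
  rewrite int_plus by c0. rewrite !int_lin by c0. rewrite h1. fold I.
  unfold m. nra. }
rewrite (int_ext (fun t => V t * V t) (fun t => 1 * (H t * H t) +
   1 * (-2 * (m / C) * (H t * Y t) + (m / C) * (m / C) * (Y t * Y t))))
  by (intro t; rewrite hV; unfold Y; ring).
rewrite int_lin by c0. rewrite int_lin by c0. fold I.
set (tau := m / C) in *.
assert (tau * tau * integral (fun t => Y t * Y t) 0 T <= tau * tau * (C * I)) by nra.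
assert (e1 : tau * tau * (C * I) = m * m / C * I) by (unfold tau; field; lra).
assert (e2 : tau * (m * I) = m * m / C * I) by (unfold tau; field; lra).
nra.
Qed.

(** * Existence for a Lipschitz nonincreasing nonlinearity *)

Lemma geometric_cauchy (f : nat -> R) (M r : R) : 0 <= M -> 0 <= r < 1 ->
  (forall n, Rabs (f (S n) - f n) <= M * r ^ n) ->
  forall n k, Rabs (f (n + k)%nat - f n) <= M / (1 - r) * r ^ n.
Proof.
intros hM hr hf n k.
assert (h : Rabs (f (n + k)%nat - f n) <= M / (1 - r) * (r ^ n - r ^ (n + k))).
{ induction k as [|k IH].
  - rewrite Nat.add_0_r. replace (f n - f n) with 0 by ring. rewrite Rabs_R0. lra.
  - rewrite Nat.add_succ_r.
    replace (f (S (n + k)) - f n) with ((f (S (n + k)) - f (n + k)%nat) + (f (n + k)%nat - f n)) by ring.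
    eapply Rle_trans; [apply Rabs_triang|].
    specialize (hf (n + k)%nat).
    replace (M / (1 - r) * (r ^ n - r ^ S (n + k))) with
      (M * r ^ (n + k) + M / (1 - r) * (r ^ n - r ^ (n + k))) by (simpl; field; lra).
    lra. }
assert (0 <= r ^ (n + k)) by (apply pow_le; lra).
assert (0 <= M / (1 - r)) by (apply Rmult_le_pos; [lra|left; apply Rinv_0_lt_compat; lra]).
nra.
Qed.

Lemma geometric_eventually_small (M r eps : R) : 0 <= r < 1 -> 0 < eps ->
  exists N, forall n, (N <= n)%nat -> M * r ^ n < eps.
Proof.
intros hr he.
assert (h : is_lim_seq (fun n => M * r ^ n) 0).
{ replace (Finite 0) with (Rbar_mult M 0) by (simpl; f_equal; ring).
  apply is_lim_seq_scal_l, is_lim_seq_geom. rewrite Rabs_pos_eq; lra. }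
apply is_lim_seq_spec in h. destruct (h (mkposreal eps he)) as [N hN].
exists N; intros n hn; specialize (hN n hn); simpl in hN.
apply Rabs_lt_between in hN; lra.
Qed.

Lemma uniform_limit (f : nat -> R -> R) (M r : R) : 0 <= M -> 0 <= r < 1 ->
  (forall n t, Rabs (f (S n) t - f n t) <= M * r ^ n) ->
  exists g : R -> R, forall n t, Rabs (g t - f n t) <= M / (1 - r) * r ^ n.
Proof.
intros hM hr hf.
exists (fun t => real (Lim_seq (fun n => f n t))). intros n t.
assert (hc := geometric_cauchy (fun k => f k t) M r hM hr (fun k => hf k t)).
assert (hl : is_lim_seq (fun k => f k t) (real (Lim_seq (fun k => f k t)))).
{ apply Lim_seq_correct'. apply ex_lim_seq_cauchy_corr. intro eps.
  destruct (geometric_eventually_small (M / (1 - r)) r (eps / 2)) as [N hN]; [assumption|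
    destruct eps; simpl; lra|].
  exists N. intros i j hi hj.
  pose proof (hc N (i - N)%nat) as h1; pose proof (hc N (j - N)%nat) as h2.
  replace (N + (i - N))%nat with i in h1 by lia; replace (N + (j - N))%nat with j in h2 by lia.
  specialize (hN N (Nat.le_refl N)).
  apply Rabs_le_between in h1, h2. apply Rabs_lt_between. lra. }
set (l := real (Lim_seq (fun k => f k t))) in *.
assert (hl' : is_lim_seq (fun k => f (k + n)%nat t - f n t) (l - f n t)).
{ apply is_lim_seq_minus'; [|apply is_lim_seq_const]. exact (proj1 (is_lim_seq_incr_n (fun k => f k t) n l) hl). }
apply is_lim_seq_abs in hl'.
refine (is_lim_seq_le _ _ _ _ _ hl' (is_lim_seq_const (M / (1 - r) * r ^ n))).
intro k; rewrite Nat.add_comm; apply hc.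
Qed.

Lemma uniform_limit_C0 (f : nat -> R -> R) (g : R -> R) (M r : R) : 0 <= r < 1 ->
  (forall n, C0 (f n)) -> (forall n t, Rabs (g t - f n t) <= M * r ^ n) -> C0 g.
Proof.
intros hr hf hg t. apply continuity_pt_filterlim. intros eps he.
destruct (geometric_eventually_small M r (eps / 3)) as [N hN]; [assumption|lra|].
specialize (hN N (Nat.le_refl N)).
destruct (C0_continuity _ (hf N) t (eps / 3)) as [d [hd hN']]; [lra|].
exists d; split; [assumption|]. intros x hx. specialize (hN' x hx).
unfold dist in *; simpl in *; unfold R_dist in *.
pose proof (hg N t) as h1; pose proof (hg N x) as h2.
apply Rabs_le_between in h1, h2. apply Rabs_lt_between in hN'. apply Rabs_lt_between. lra.
Qed.

Lemma lipschitz_C0 (G : R -> R) (K : R) : 0 <= K ->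
  (forall x y, Rabs (G x - G y) <= K * Rabs (x - y)) -> C0 G.
Proof.
intros hK hG t. apply continuity_pt_filterlim. intros eps he.
exists (eps / (K + 1)). split; [apply Rdiv_lt_0_compat; lra|].
intros x [_ hx]. unfold dist in *; simpl in *; unfold R_dist in *.
eapply Rle_lt_trans; [apply hG|].
assert (e : eps = (K + 1) * (eps / (K + 1))) by (field; lra).
rewrite e at 1. pose proof (Rabs_pos (x - t)). nra.
Qed.

(** The derivatives are existential so that they can be given by formulas rather than by
    [Derive], and gamma stands for the nonlinear term evaluated along u, so that the true
    and the frozen nonlinearity are treated together. *)
Definition forced_solution (T c b mu : R) (gamma e u : R -> R) : Prop :=
  exists du ddu : R -> R,
    (forall t, is_derive u t (du t)) /\ (forall t, is_derive du t (ddu t)) /\ C0 ddu /\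
    periodic T u /\ forall t, ddu t + c * du t + b * u t + gamma t = mu + e t.

Definition regular (T : R) (U : R -> R) : Prop :=
  (forall t, is_derive U t (Derive U t)) /\ C0 (Derive U) /\ periodic T U /\ integral U 0 T = 0.

Lemma regular_intro (T : R) (U dU : R -> R) :
  (forall t, is_derive U t (dU t)) -> C0 dU -> periodic T U -> integral U 0 T = 0 ->
  regular T U /\ Derive U = dU.
Proof.
intros h1 h2 h3 h4.
assert (e : Derive U = dU) by (apply functional_extensionality; intro; apply is_derive_unique, h1).
split; [|assumption]. split; [|split; [|split]]; try rewrite e; assumption.
Qed.

(** The iterates U_n of [contraction] are Cauchy for int U'^2, hence uniformly by
    [sup_bound].  The fixed point map involves no derivative of U, only primitives, so it is
    continuous for uniform convergence and the limit is a fixed point; being a combination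
    of double primitives, the limit is then twice differentiable and solves the equation.
    The multiplier mu comes out as b xi plus the mean of gamma. *)
Lemma lipschitz_existence (T lam c b K A xi : R) (a e G : R -> R) :
  0 < T -> 0 < lam -> lam * T < 2 * PI -> 0 < b < lam * lam -> 0 <= K ->
  C0 a -> periodic T a -> (forall t, 0 <= a t <= A) ->
  C0 e -> periodic T e -> integral e 0 T = 0 ->
  (forall x y, Rabs (G x - G y) <= K * Rabs (x - y)) ->
  (forall x y, x <= y -> G y <= G x) ->
  exists mu u, forced_solution T c b mu (fun t => a t * G (u t)) e u /\
    integral u 0 T = T * xi.
Proof.
intros hT hlam hlT hb hK ca pa haA ce pe me hGK hGm.
assert (hA : 0 <= A) by (specialize (haA 0); lra).
assert (cG : C0 G) by (apply (lipschitz_C0 G K); assumption).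
assert (hAK : 0 <= A * K) by nra.
destruct (contraction T lam c b (A * K) hT hlam hlT hb hAK) as [tau [q [htau [hq hcontr]]]].
set (J := mean_zero_primitive T) in *.
set (k := sqrt ((1 + / (lam * lam)) * T)).
assert (hk : 0 <= k) by apply sqrt_pos.
assert (Jc : forall f, C0 f -> C0 (J f)) by (intros; apply mean_zero_primitive_C0; assumption).
assert (Jp : forall f, C0 f -> periodic T f -> periodic T (J f)) by (intros; apply mean_zero_primitive_per; assumption).
assert (Jm : forall f, C0 f -> integral (J f) 0 T = 0) by (intros; apply mean_zero_primitive_mean; assumption).
assert (Jd : forall f, C0 f -> forall t, is_derive (J f) t (center T f t)) by (intros f hf t; apply mean_zero_primitive_derive, hf).
assert (Jmin : forall f g, C0 f -> C0 g -> J (fun s => f s - g s) = fun s => J f s - J g s).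
{ intros f g hf hg; apply functional_extensionality; intro; apply mean_zero_primitive_minus; assumption. }
assert (Jsup : forall f M t, C0 f -> periodic T f -> 0 <= M -> (forall s, Rabs (f s) <= M) ->
   Rabs (J f t) <= k * M) by (intros; apply mean_zero_primitive_sup; assumption).
(* Only these properties of J matter; hiding its body keeps unification from unfolding
   integrals. *)
clearbody J.
set (gam := fun (U : R -> R) t => a t * G (xi + U t)).
assert (cgam : forall U, C0 U -> C0 (gam U)).
{ intros U hU; unfold gam; apply C0_mult; [assumption|].
  apply (C0_comp (fun t => xi + U t) G); [c0|assumption]. }
assert (pgam : forall U, periodic T U -> periodic T (gam U)).
{ intros U hU t; unfold gam; rewrite pa, hU; reflexivity. }
assert (gamK : forall U V t, Rabs (gam U t - gam V t) <= A * K * Rabs (U t - V t)).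
{ intros U V t; unfold gam.
  replace (a t * G (xi + U t) - a t * G (xi + V t)) with (a t * (G (xi + U t) - G (xi + V t))) by ring.
  rewrite Rabs_mult, (Rabs_pos_eq (a t)) by apply haA.
  specialize (hGK (xi + U t) (xi + V t)).
  replace (xi + U t - (xi + V t)) with (U t - V t) in hGK by ring.
  specialize (haA t). pose proof (Rabs_pos (G (xi + U t) - G (xi + V t))).
  rewrite Rmult_assoc; apply Rmult_le_compat; lra. }
assert (gamm : forall U V t, (gam U t - gam V t) * (U t - V t) <= 0).
{ intros U V t; unfold gam. specialize (haA t).
  destruct (Rle_dec (U t) (V t)) as [h|h].
  - pose proof (hGm (xi + U t) (xi + V t) ltac:(lra)). 
    assert (0 <= a t * (G (xi + U t) - G (xi + V t))) by nra. nra.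
  - pose proof (hGm (xi + V t) (xi + U t) ltac:(lra)).
    assert (0 <= a t * (G (xi + V t) - G (xi + U t))) by nra. nra. }
(* F U = U + K (c U' + b U + gamma - e), with K = J J and K U' = J U for U of mean zero. *)
set (F := fun U t => U t + c * J U t + b * J (J U) t + J (J (gam U)) t - J (J e) t).
set (step := fun U t => U t - tau * F U t).
assert (hstep : forall U, regular T U -> regular T (step U) /\
   Derive (step U) = fun t => Derive U t - tau * (Derive U t + c * U t + b * J U t + J (gam U) t - J e t)).
{ intros U [h1 [h2 [h3 h4]]].
  pose proof (C0_derivable _ _ h1) as cU.
  assert (c1 := Jc U cU). assert (c2 := Jc _ (cgam U cU)). assert (c3 := Jc e ce).

  assert (c4 := Jc _ c1). assert (c5 := Jc _ c2). assert (c6 := Jc _ c3).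

  assert (p1 := Jp U cU h3). assert (p2 := Jp _ (cgam U cU) (pgam U h3)).
  assert (p3 := Jp e ce pe).
  assert (p4 := Jp _ c1 p1). assert (p5 := Jp _ c2 p2).
  assert (p6 := Jp _ c3 p3).
  apply regular_intro.
  - intro t.
    assert (d1 := Jd U cU). assert (d2 := Jd _ c1).
    assert (d3 := Jd _ c2). assert (d4 := Jd _ c3).

    unfold step, F. der. cbv beta.
    rewrite !center_id by (assumption || apply Jm; auto). ring.
  - c0.
  - unfold step, F; per.
  - unfold step, F.
    rewrite int_minus, int_scal by c0. rewrite !int_minus, !int_plus, !int_scal by c0.
    rewrite !Jm by auto. rewrite h4; ring. }
set (Un := fix Un n := match n with O => fun _ : R => 0 | S n => step (Un n) end).
assert (hreg : forall n, regular T (Un n)).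
{ induction n as [|n IH].
  - apply (regular_intro T (fun _ => 0) (fun _ => 0)); [intro; der|c0|per|rewrite int_const; ring].
  - apply hstep, IH. }
assert (cUn : forall n, C0 (Un n)) by (intro n; apply (C0_derivable _ _ (proj1 (hreg n)))).
set (nrm := fun n => integral (fun t => (Derive (Un (S n)) t - Derive (Un n) t) * (Derive (Un (S n)) t - Derive (Un n) t)) 0 T).
assert (hD : forall n t, Derive (Un (S n)) t = Derive (Un n) t -
   tau * (Derive (Un n) t + c * Un n t + b * J (Un n) t + J (gam (Un n)) t - J e t)).
{ intros n t. change (Un (S n)) with (step (Un n)). rewrite (proj2 (hstep _ (hreg n))). reflexivity. }
assert (hnrm : forall n, nrm (S n) <= q * nrm n).
{ intro n. unfold nrm.
  destruct (hreg n) as [a1 [a2 [a3 a4]]]. destruct (hreg (S n)) as [b1 [b2 [b3 b4]]].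
  pose proof (cUn n) as ca1; pose proof (cUn (S n)) as cb1.
  apply (hcontr (fun t => Un (S n) t - Un n t) (fun t => Derive (Un (S n)) t - Derive (Un n) t)
     (fun t => gam (Un (S n)) t - gam (Un n) t)).
  - intro t; der.
  - c0.
  - per.
  - rewrite int_minus, a4, b4 by assumption; ring.
  - apply C0_minus; apply cgam; assumption.
  - apply per_minus; apply pgam; assumption.
  - intro t; apply gamm.
  - intro t; apply gamK.
  - intro t. rewrite !Jmin by auto.
    rewrite (hD (S n) t). pose proof (hD n t). lra. }
set (N0 := nrm 0%nat).
assert (hN0 : 0 <= N0).
{ apply (int_square (fun t => Derive (Un 1%nat) t - Derive (Un 0%nat) t)); [lra|].
  apply C0_minus; apply hreg. }
assert (hgeo : forall n, nrm n <= N0 * q ^ n).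
{ induction n as [|n IH]; [simpl; fold N0; lra|].
  specialize (hnrm n). simpl. assert (q * nrm n <= q * (N0 * q ^ n)) by (apply Rmult_le_compat_l; lra). lra. }
set (L := 1 + / (lam * lam)).
assert (hL : 0 < L) by (assert (0 < / (lam * lam)) by (apply Rinv_0_lt_compat; nra); unfold L; lra).
set (r := sqrt q).
assert (hr : 0 <= r < 1).
{ split; [apply sqrt_pos|]. unfold r; rewrite <- sqrt_1. apply sqrt_lt_1_alt; lra. }
assert (hsup : forall n t, Rabs (Un (S n) t - Un n t) <= sqrt (L * N0) * r ^ n).
{ intros n t.
  destruct (hreg n) as [a1 [a2 [a3 a4]]]. destruct (hreg (S n)) as [b1 [b2 [b3 b4]]].
  pose proof (cUn n) as ca1; pose proof (cUn (S n)) as cb1.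
  assert (h : (Un (S n) t - Un n t) * (Un (S n) t - Un n t) <= L * nrm n).
  { apply (sup_bound T lam (fun t => Un (S n) t - Un n t)
      (fun t => Derive (Un (S n)) t - Derive (Un n) t)); try assumption.
    - intro s; der.
    - c0.
    - per.
    - rewrite int_minus, a4, b4 by assumption; ring. }
  assert (hrn : 0 <= r ^ n) by (apply pow_le; lra).
  rewrite <- sqrt_Rsqr_abs. rewrite <- (sqrt_Rsqr (r ^ n)) by assumption.
  rewrite <- sqrt_mult_alt by nra. apply sqrt_le_1_alt.
  unfold Rsqr. rewrite <- Rpow_mult_distr.
  replace (r * r) with q by (symmetry; apply sqrt_sqrt; lra).
  specialize (hgeo n). nra. }
destruct (uniform_limit Un (sqrt (L * N0)) r) as [U hU]; [apply sqrt_pos|assumption|assumption|].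
set (M := sqrt (L * N0) / (1 - r)) in *.
assert (cU : C0 U) by (apply (uniform_limit_C0 Un U M r); assumption).
assert (hM : 0 <= M).
{ apply Rmult_le_pos; [apply sqrt_pos|]. left; apply Rinv_0_lt_compat; lra. }
assert (hsmall : forall eps, 0 < eps -> exists N, forall n t, (N <= n)%nat -> Rabs (U t - Un n t) < eps).
{ intros eps heps. destruct (geometric_eventually_small M r eps hr heps) as [N hN].
  exists N; intros n t hn. eapply Rle_lt_trans; [apply hU|apply hN, hn]. }
assert (pU : periodic T U).
{ intro t. apply Rminus_diag_uniq, Rabs_eq_0, Rle_antisym; [|apply Rabs_pos].
  apply le_epsilon; intros eps heps.
  destruct (hsmall (eps / 2) ltac:(lra)) as [N hN].
  pose proof (hN N t (Nat.le_refl N)) as h1; pose proof (hN N (t + T) (Nat.le_refl N)) as h2.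
  rewrite (proj1 (proj2 (proj2 (hreg N)))) in h2.
  apply Rabs_lt_between in h1, h2. apply Rabs_le_between. lra. }
(* F is Lipschitz in the supremum norm and F U_n = (U_n - U_(n+1)) / tau tends to 0. *)
set (B := 1 + Rabs c * k + b * (k * k) + k * (k * (A * K))).
assert (hFlip : forall n t m, (forall s, Rabs (U s - Un n s) <= m) -> Rabs (F U t - F (Un n) t) <= B * m).
{ intros n t m hm.
  assert (hm0 : 0 <= m) by (eapply Rle_trans; [apply Rabs_pos|apply (hm 0)]).
  pose proof (cUn n) as cn. pose proof (proj1 (proj2 (proj2 (hreg n)))) as pn.
  set (W := fun s => U s - Un n s). set (D := fun s => gam U s - gam (Un n) s).
  assert (cW : C0 W) by (unfold W; c0). assert (pW : periodic T W) by (unfold W; per).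
  assert (cD : C0 D) by (apply C0_minus; apply cgam; assumption).
  assert (pD : periodic T D) by (apply per_minus; apply pgam; assumption).
  assert (hD' : forall s, Rabs (D s) <= A * K * m).
  { intro s; eapply Rle_trans; [apply gamK|]. apply Rmult_le_compat_l; [assumption|apply hm]. }
  assert (cJW : C0 (J W)) by (apply Jc; assumption).
  assert (pJW : periodic T (J W)) by (apply Jp; assumption).
  assert (cJD : C0 (J D)) by (apply Jc; assumption).
  assert (pJD : periodic T (J D)) by (apply Jp; assumption).
  assert (j1 : forall s, Rabs (J W s) <= k * m) by (intro; apply Jsup; assumption).
  assert (j2 : Rabs (J (J W) t) <= k * (k * m)) by (apply Jsup; try assumption; nra).
  assert (j3 : forall s, Rabs (J D s) <= k * (A * K * m)) by (intro; apply Jsup; try assumption; nra).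
  assert (j4 : Rabs (J (J D) t) <= k * (k * (A * K * m))).
  { apply Jsup; try assumption. apply Rmult_le_pos; [assumption|nra]. }
  assert (e1 : J W = fun s => J U s - J (Un n) s) by (apply Jmin; assumption).
  assert (e2 : J (J W) = fun s => J (J U) s - J (J (Un n)) s).
  { rewrite e1; apply Jmin; apply Jc; assumption. }
  assert (e3 : J D = fun s => J (gam U) s - J (gam (Un n)) s) by (apply Jmin; apply cgam; assumption).
  assert (e4 : J (J D) = fun s => J (J (gam U)) s - J (J (gam (Un n))) s).
  { rewrite e3; apply Jmin; apply Jc, cgam; assumption. }
  replace (F U t - F (Un n) t) with (((W t + c * J W t) + b * J (J W) t) + J (J D) t)
    by (rewrite e4, e2, e1; unfold F, W; ring).
  eapply Rle_trans; [apply Rabs_triang|].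
  eapply Rle_trans; [apply Rplus_le_compat_r, Rabs_triang|].
  eapply Rle_trans; [apply Rplus_le_compat_r, Rplus_le_compat_r, Rabs_triang|].
  rewrite !Rabs_mult, (Rabs_pos_eq b) by lra.
  specialize (hm t); fold (W t) in hm.
  assert (Rabs c * Rabs (J W t) <= Rabs c * (k * m)).
  { apply Rmult_le_compat_l; [apply Rabs_pos|apply j1]. }
  assert (b * Rabs (J (J W) t) <= b * (k * (k * m))) by (apply Rmult_le_compat_l; lra).
  unfold B. lra. }
assert (hB : 0 < B).
{ unfold B. pose proof (Rabs_pos c). 
  assert (0 <= Rabs c * k) by nra. assert (0 <= k * k) by nra. assert (0 <= k * (A * K)) by nra. nra. }
assert (hF0 : forall t, F U t = 0).
{ intro t. apply Rabs_eq_0, Rle_antisym; [|apply Rabs_pos].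
  apply le_epsilon; intros eps heps.
  set (e1 := Rmin (eps / (2 * B)) (tau * eps / 4)).
  assert (he1 : 0 < e1).
  { apply Rmin_glb_lt; [apply Rdiv_lt_0_compat; lra|nra]. }
  destruct (hsmall e1 he1) as [N hN].
  assert (h1 := hFlip N t e1 (fun s => Rlt_le _ _ (hN N s (Nat.le_refl N)))).
  pose proof (hN N t (Nat.le_refl N)) as h2.
  pose proof (hN (S N) t (Nat.le_succ_diag_r N)) as h3.
  assert (h4 : Un (S N) t = Un N t - tau * F (Un N) t) by reflexivity.
  assert (h5 : B * e1 <= eps / 2).
  { apply Rle_trans with (B * (eps / (2 * B))); [|right; field; lra].
    apply Rmult_le_compat_l; [lra|apply Rmin_l]. }
  assert (h6 : e1 <= tau * eps / 4) by apply Rmin_r.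
  assert (h7 : Rabs (F (Un N) t) <= eps / 2).
  { apply Rabs_lt_between in h2, h3. apply Rabs_le_between.
    split; apply (Rmult_le_reg_l tau); nra. }
  apply Rabs_le_between in h1, h7. apply Rabs_le_between. lra. }
clear hFlip hsmall hU hsup hgeo hnrm hD hcontr.
(* F U = 0 expresses U through primitives of continuous functions. *)
pose proof (cgam U cU) as cgU. pose proof (pgam U pU) as pgU.
assert (c1 := Jc U cU). assert (c2 := Jc _ cgU). assert (c3 := Jc e ce).

assert (c4 := Jc _ c1). assert (c5 := Jc _ c2). assert (c6 := Jc _ c3).

assert (eU : U = fun t => J (J e) t - J (J (gam U)) t - b * J (J U) t - c * J U t).
{ apply functional_extensionality; intro t. specialize (hF0 t). unfold F in hF0. lra. }
assert (mU : integral U 0 T = 0).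
{ rewrite eU. rewrite !int_minus, !int_scal by c0.
  rewrite !Jm by auto. ring. }
assert (dJ : forall f, C0 f -> integral f 0 T = 0 -> forall t, is_derive (J f) t (f t)).
{ intros f hf mf t; eapply is_derive_eq; [apply Jd, hf|apply center_id, mf]. }
assert (dJJ : forall f, C0 f -> forall t, is_derive (J (J f)) t (J f t)).
{ intros f hf; apply dJ; [apply Jc, hf|apply Jm; assumption]. }
assert (d1 := dJ U cU mU). assert (d2 := dJJ U cU). assert (d3 := dJJ _ cgU). assert (d4 := dJJ e ce).
assert (d5 := Jd _ cgU). assert (d6 := dJ e ce me).
set (dU := fun t => J e t - J (gam U) t - b * J U t - c * U t).
assert (hdU : forall t, is_derive U t (dU t)).
{ intro t. rewrite eU at 1. unfold dU. der. }
set (ddU := fun t => e t - center T (gam U) t - b * U t - c * dU t).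
assert (hddU : forall t, is_derive dU t (ddU t)).
{ intro t. unfold ddU. unfold dU at 1. der. }
pose proof (C0_derivable _ _ hddU) as cdU.
pose proof (center_C0 T _ cgU) as ccg.
exists (b * xi + / T * integral (gam U) 0 T), (fun t => xi + U t).
split.
- exists dU, ddU. split; [|split; [|split; [|split]]].
  + intro t; der.
  + assumption.
  + unfold ddU; c0.
  + per.
  + intro t; unfold ddU, center. fold (gam U t). ring.
- rewrite int_plus, mU, int_const by c0. ring.
Qed.

(** * The singular nonlinearity *)

(** Kept as a single function, since only its sign, monotonicity, convexity and growth
    at 0 are used. *)
Definition negpow (p x : R) : R := Rpower x (- p).

Definition dnegpow (p x : R) : R := - p * Rpower x (- p - 1).

Lemma negpow_pos (p x : R) : 0 < negpow p x.
Proof. apply exp_pos. Qed.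

Lemma negpow_derive (p x : R) : 0 < x -> is_derive (negpow p) x (dnegpow p x).
Proof.
intro hx. apply is_derive_Reals. unfold negpow, dnegpow.
apply (derivable_pt_lim_power x (- p) hx).
Qed.

Lemma Rpower_neg_decr (q x y : R) : 0 < q -> 0 < x -> x < y -> Rpower y (- q) < Rpower x (- q).
Proof.
intros hq hx hxy. unfold Rpower. apply exp_increasing.
pose proof (ln_increasing x y hx hxy). nra.
Qed.

Lemma dnegpow_incr (p x y : R) : 0 < p -> 0 < x -> x < y -> dnegpow p x < dnegpow p y.
Proof.
intros hp hx hxy; unfold dnegpow.
pose proof (Rpower_neg_decr (p + 1) x y ltac:(lra) hx hxy) as h.
replace (- (p + 1)) with (- p - 1) in h by ring. nra.
Qed.

Lemma dnegpow_neg (p x : R) : 0 < p -> dnegpow p x < 0.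
Proof.
intro hp; unfold dnegpow. pose proof (exp_pos ((- p - 1) * ln x)) as h.
unfold Rpower; nra.
Qed.

Lemma negpow_slope (p x y : R) : 0 < x -> x < y ->
  exists z, x < z < y /\ negpow p y - negpow p x = dnegpow p z * (y - x).
Proof.
intros hx hxy.
destruct (MVT_cor2 (negpow p) (dnegpow p) x y hxy) as [z [h1 h2]].
- intros z hz; apply is_derive_Reals, negpow_derive; lra.
- exists z; split; assumption.
Qed.

Lemma negpow_decr (p x y : R) : 0 < p -> 0 < x -> x < y -> negpow p y < negpow p x.
Proof. intros; apply Rpower_neg_decr; assumption. Qed.

Lemma negpow_decr_le (p x y : R) : 0 < p -> 0 < x -> x <= y -> negpow p y <= negpow p x.
Proof.
intros hp hx [h| ->]; [left; apply negpow_decr; assumption | right; reflexivity].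
Qed.

Lemma negpow_lipschitz (p d x y : R) : 0 < p -> 0 < d -> d <= x -> d <= y ->
  Rabs (negpow p x - negpow p y) <= - dnegpow p d * Rabs (x - y).
Proof.
intros hp hd.
assert (hlt : forall x y, d <= x -> x < y -> Rabs (negpow p x - negpow p y) <= - dnegpow p d * Rabs (x - y)).
{ clear x y; intros x y hx hxy.
  destruct (negpow_slope p x y ltac:(lra) hxy) as [z [hz e]].
  replace (negpow p x - negpow p y) with (dnegpow p z * (x - y)) by (rewrite <- (Ropp_minus_distr (negpow p y)), e; ring).
  rewrite Rabs_mult. apply Rmult_le_compat_r; [apply Rabs_pos|].
  rewrite Rabs_left by (apply dnegpow_neg, hp).
  pose proof (dnegpow_incr p d z hp hd ltac:(lra)); lra. }
intros hx hy. destruct (Rtotal_order x y) as [h|[->|h]].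
- apply hlt; assumption.
- unfold Rminus; rewrite !Rplus_opp_r, Rabs_R0; lra.
- rewrite (Rabs_minus_sym (negpow p x)), (Rabs_minus_sym x). apply hlt; assumption.
Qed.

(** Chord slopes increase; denominators are cleared. *)
Lemma negpow_convex (p x y z : R) : 0 < p -> 0 < x -> x < y -> y < z ->
  (negpow p y - negpow p x) * (z - y) < (negpow p z - negpow p y) * (y - x).
Proof.
intros hp hx hxy hyz.
destruct (negpow_slope p x y hx hxy) as [s [hs ->]].
destruct (negpow_slope p y z ltac:(lra) hyz) as [r [hr ->]].
pose proof (dnegpow_incr p s r hp ltac:(lra) ltac:(lra)).
assert (0 < (y - x) * (z - y)) by nra. nra.
Qed.

Lemma negpow_blowup (p M : R) : 0 < p -> exists d, 0 < d /\ M < negpow p d.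
Proof.
intro hp. set (N := Rabs M + 1).
assert (hN : 0 < N) by (unfold N; pose proof (Rabs_pos M); lra).
exists (Rpower N (- / p)); split; [apply exp_pos|].
unfold negpow; rewrite Rpower_mult.
replace (- / p * - p) with 1 by (field; lra). rewrite Rpower_1 by assumption.
unfold N; pose proof (Rle_abs M); lra.
Qed.

Lemma C0_negpow (p : R) (u : R -> R) : C0 u -> (forall t, 0 < u t) -> C0 (fun t => negpow p (u t)).
Proof.
intros hu pu t. apply (continuous_comp u (negpow p)); [apply hu|].
apply (ex_derive_continuous (negpow p)). eexists; apply negpow_derive, pu.
Qed.

(** Freezing the argument below d makes the nonlinearity globally Lipschitz while keeping
    it nonincreasing. *)
Definition truncated (p d x : R) : R := negpow p (Rmax x d).

Lemma truncated_lipschitz (p d x y : R) : 0 < p -> 0 < d ->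
  Rabs (truncated p d x - truncated p d y) <= - dnegpow p d * Rabs (x - y).
Proof.
intros hp hd; unfold truncated.
eapply Rle_trans; [apply (negpow_lipschitz p d); auto using Rmax_r|].
apply Rmult_le_compat_l; [pose proof (dnegpow_neg p d hp); lra|].
unfold Rmax; repeat destruct Rle_dec; unfold Rabs; repeat destruct Rcase_abs; lra.
Qed.

Lemma truncated_decr (p d x y : R) : 0 < p -> 0 < d -> x <= y -> truncated p d y <= truncated p d x.
Proof.
intros hp hd h; apply negpow_decr_le; [assumption| |apply Rle_max_compat_r, h].
eapply Rlt_le_trans; [exact hd|apply Rmax_r].
Qed.

(** * A priori bounds *)

Lemma derive_at_max (f df : R -> R) (t : R) :
  (forall s, is_derive f s (df s)) -> (forall s, f s <= f t) -> df t = 0.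
Proof.
intros hf hmax.
pose (pr := exist (fun l => derivable_pt_lim f t l) (df t) (proj1 (is_derive_Reals f t (df t)) (hf t)) : derivable_pt f t).
change (derive_pt f t pr = 0).
apply (deriv_maximum f (t - 1) (t + 1)); intros; try lra; apply hmax.
Qed.

(** If ddf t > 0 then df > 0 just to the right of t, so f would exceed its maximum. *)
Lemma second_derive_at_max (f df ddf : R -> R) (t : R) :
  (forall s, is_derive f s (df s)) -> (forall s, is_derive df s (ddf s)) ->
  (forall s, f s <= f t) -> df t = 0 /\ ddf t <= 0.
Proof.
intros hf hdf hmax.
pose proof (derive_at_max f df t hf hmax) as h0. split; [assumption|].
apply Rnot_lt_le; intro hpos.
destruct (proj1 (is_derive_Reals df t (ddf t)) (hdf t) (ddf t / 2) ltac:(lra)) as [d hd].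
pose proof (cond_pos d) as dpos.
destruct (MVT_cor2 f df t (t + d / 2)) as [s [h1 h2]]; [lra|intros; apply is_derive_Reals, hf|].
specialize (hd (s - t) ltac:(lra) ltac:(apply Rabs_lt_between; lra)).
replace (t + (s - t)) with s in hd by ring. rewrite h0, Rminus_0_r in hd.
apply Rabs_lt_between in hd.
assert (hq : 0 < df s / (s - t)) by lra.
assert (e : df s = df s / (s - t) * (s - t)) by (field; lra).
assert (hds : 0 < df s) by (rewrite e; apply Rmult_lt_0_compat; lra).
pose proof (hmax (t + d / 2)). nra.
Qed.

Lemma forced_energy_form (T c b mu xi : R) (gamma e u : R -> R) : 0 < T ->
  forced_solution T c b mu gamma e u -> integral u 0 T = T * xi ->
  exists H D : R -> R,
    (forall t, is_derive (fun s => u s - xi) t (H t)) /\ (forall t, is_derive H t (D t)) /\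
    periodic T (fun s => u s - xi) /\ integral (fun s => u s - xi) 0 T = 0 /\
    (forall t, is_derive u t (H t)) /\ C0 D /\
    forall t, D t + c * H t + b * u t + gamma t = mu + e t.
Proof.
intros hT [H [D [h1 [h2 [h3 [h4 h5]]]]]] mu0.
pose proof (C0_derivable _ _ h1) as cu.
exists H, D. split; [intro t; der|]. split; [assumption|]. split; [per|].
split; [|split; [|split]; assumption].
rewrite int_minus, int_const, mu0 by c0. ring.
Qed.

Lemma forced_mean (T c b mu xi : R) (gamma e u : R -> R) : 0 < T ->
  C0 gamma -> C0 e -> integral e 0 T = 0 ->
  forced_solution T c b mu gamma e u -> integral u 0 T = T * xi ->
  integral gamma 0 T = T * (mu - b * xi).
Proof.
intros hT cg ce me [H [D [h1 [h2 [h3 [h4 h5]]]]]] mu0.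
pose proof (C0_derivable _ _ h1) as cu. pose proof (C0_derivable _ _ h2) as cH.
pose proof (per_derive _ _ _ h1 h4) as pH.
assert (h : integral (fun t => D t + c * H t) 0 T = 0).
{ apply (int_periodic_derive T (fun t => H t + c * u t)); [intro; der|c0|per]. }
rewrite (int_ext gamma (fun t => (mu + e t) - b * u t - (D t + c * H t))) by (intro t; rewrite <- h5; ring).
rewrite !int_minus, int_plus, int_scal, int_const, h, me, mu0 by c0. ring.
Qed.

(** Bounds that depend on the nonlinearity only through its value kappa at the average,
    so that they are uniform in the freezing level.  The energy estimate bounds u - xi; at a
    maximum u >= xi, hence h <= kappa, and u'' <= 0 turns the equation into an upper bound
    for mu; at a minimum u'' >= 0 gives the last inequality, which keeps u away from the
    singularity. *)
Lemma apriori (T lam c b amin A E : R) (a e : R -> R) :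
  0 < T -> 0 < lam -> lam * T < 2 * PI -> 0 < b < lam * lam ->
  C0 a -> 0 < amin -> (forall t, amin <= a t <= A) ->
  C0 e -> (forall t, Rabs (e t) <= E) ->
  exists S, 0 <= S /\ forall (xi kappa mu : R) (u h : R -> R),
    0 <= kappa -> C0 h ->
    (forall t, 0 <= h t) ->
    (forall t, u t <= xi -> kappa <= h t) -> (forall t, xi <= u t -> h t <= kappa) ->
    forced_solution T c b mu (fun t => a t * h t) e u -> integral u 0 T = T * xi ->
    (forall t, Rabs (u t - xi) <= S * (A * kappa + E)) /\
    mu <= b * (xi + S * (A * kappa + E)) + (A * kappa + E) /\
    exists s, (forall t, u s <= u t) /\ amin * h s <= mu + E - b * u s.
Proof.
intros hT hlam hlT hb ca hamin ha ce he.
set (L := / (lam * lam)).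
assert (hL : 0 < L) by (apply Rinv_0_lt_compat; nra).
assert (hLl : L * (lam * lam) = 1) by (unfold L; field; nra).
set (m := 1 - b / (lam * lam)).
assert (hm : 0 < m) by (unfold m, Rdiv; fold L; nra).
set (Q := (1 + L) * (T * (/ m * / m * L))).
assert (hQ : 0 <= Q).
{ assert (0 < / m) by (apply Rinv_0_lt_compat; lra).
  unfold Q. repeat apply Rmult_le_pos; lra. }
exists (sqrt Q); split; [apply sqrt_pos|].
intros xi kappa mu u h hk ch hh0 hlow hup hsol hmean.
destruct (forced_energy_form T c b mu xi _ e u hT hsol hmean) as [H [D [d1 [d2 [pU [mU [d0 [cD heq]]]]]]]].
pose proof (C0_derivable _ _ d0) as cu. pose proof (C0_derivable _ _ d2) as cH.
assert (hA : 0 < A) by (specialize (ha 0); lra).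
assert (hE : 0 <= E) by (eapply Rle_trans; [apply Rabs_pos|apply (he 0)]).
set (N := A * kappa + E).
assert (hN : 0 <= N) by (unfold N; nra).
assert (hsup : forall t, Rabs (u t - xi) <= sqrt Q * N).
{ set (I := integral (fun t => H t * H t) 0 T).
  assert (h1 : m * I <= integral (fun t => (a t * h t - e t) * (u t - xi)) 0 T).
  { apply (energy_coercive T lam c b (mu - b * xi) (fun t => u t - xi) H D (fun t => a t * h t - e t)); try assumption; try lra; try c0.
    intro t; specialize (heq t); lra. }
  (* h may be replaced by kappa because (h - kappa) (u - xi) <= 0; Young's inequality with
     weight m lam^2 then leaves half of the coercive term. *)
  assert (h2 : integral (fun t => (a t * h t - e t) * (u t - xi)) 0 T <=
     integral (fun t => (N * N * / m * L / 2) * 1 + (m * (lam * lam) / 2) * ((u t - xi) * (u t - xi))) 0 T).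
  { apply int_le; [lra|c0|c0|]. intro t.
    apply Rle_trans with ((a t * kappa - e t) * (u t - xi)).
    - specialize (ha t). destruct (Rle_dec (u t) xi) as [hle|hle].
      + specialize (hlow t hle). assert (0 <= a t * (h t - kappa)) by nra. nra.
      + specialize (hup t ltac:(lra)). assert (0 <= a t * (kappa - h t)) by nra. nra.
    - set (y := u t - xi). set (g := a t * kappa - e t).
      assert (hg : Rabs g <= N).
      { specialize (ha t); specialize (he t). unfold g, N.
        apply Rabs_le_between in he. apply Rabs_le_between.
        assert (0 <= a t * kappa <= A * kappa) by (split; nra). lra. }
      set (s := m * (lam * lam)).
      assert (hs : 0 < s) by (unfold s; nra).
      assert (es : / m * L = / s) by (unfold s, L; field; nra).
      replace (N * N * / m * L / 2) with (N * N * / s / 2) by (rewrite <- es; field; lra).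
      assert (hgg : g * g <= N * N).
      { rewrite <- (Rabs_pos_eq N hN) in hg. apply Rsqr_le_abs_1 in hg. exact hg. }
      apply (Rmult_le_reg_l (2 * s)); [lra|].
      replace (2 * s * (N * N * / s / 2 * 1 + s / 2 * (y * y))) with (N * N + (s * y) * (s * y)) by (field; lra).
      pose proof (Rle_0_sqr (g - s * y)) as hsq; unfold Rsqr in hsq. nra. }
  rewrite int_lin, int_const in h2 by c0.
  pose proof (poincare T lam _ H hT hlam hlT d1 cH pU mU) as h3. fold I in h3.
  assert (h4 : I <= T * (/ m * / m * L) * (N * N)).
  { apply (Rmult_le_reg_l (m / 2)); [lra|].
    replace (m / 2 * (T * (/ m * / m * L) * (N * N))) with (N * N * / m * L / 2 * ((T - 0) * 1)) by (field; lra).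
    assert (m / 2 * (lam * lam * integral (fun t => (u t - xi) * (u t - xi)) 0 T) <= m / 2 * I)
      by (apply Rmult_le_compat_l; lra).
    lra. }
  intro t.
  rewrite <- sqrt_Rsqr_abs. rewrite <- (sqrt_Rsqr N) by assumption.
  rewrite <- sqrt_mult_alt by assumption. apply sqrt_le_1_alt. unfold Rsqr.
  eapply Rle_trans; [apply (sup_bound T lam (fun s => u s - xi) H t); assumption|].
  fold L I. unfold Q. rewrite Rmult_assoc. apply Rmult_le_compat_l; lra. }
assert (pu : periodic T u).
{ intro t; specialize (pU t); simpl in pU; lra. }
split; [assumption|]. split.
- destruct (periodic_max T u hT cu pu) as [s hs].
  destruct (second_derive_at_max u H D s d0 d2 hs) as [e1 e2].
  assert (cU : C0 (fun t => u t - xi)) by c0.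
  destruct (mean_zero_vanishes T _ hT cU mU) as [z hz]. cbv beta in hz.
  pose proof (hs z) as hz'.
  specialize (hup s ltac:(lra)). pose proof (hh0 s) as hh0s.
  specialize (heq s). rewrite e1 in heq. specialize (hsup s). specialize (ha s). specialize (he s).
  apply Rabs_le_between in hsup, he.
  assert (a s * h s <= A * kappa) by nra.
  assert (b * u s <= b * (xi + sqrt Q * N)) by nra.
  unfold N in *. lra.
- destruct (periodic_min T u hT cu pu) as [s hs]. exists s; split; [assumption|].
  destruct (second_derive_at_max (fun t => - u t) (fun t => - H t) (fun t => - D t) s) as [e1 e2].
  + intro t; der.
  + intro t; der.
  + intro t; specialize (hs t); lra.
  + specialize (heq s). specialize (ha s). specialize (he s). pose proof (hh0 s).
    apply Rabs_le_between in he.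
    assert (amin * h s <= a s * h s) by nra.
    replace (H s) with 0 in heq by lra. lra.
Qed.

(** * Positive periodic solutions with a prescribed average *)

(** Passage between the iterated derivatives [Derive_n] and explicit ones. *)
Lemma positive_solution_iff (T p c b mu : R) (a e u : R -> R) :
  positive_periodic_solution T p c b a e mu u <->
  (forced_solution T c b mu (fun t => a t * negpow p (u t)) e u /\ forall t, 0 < u t).
Proof.
assert (epw : forall t, a t / Rpower (u t) p = a t * negpow p (u t)).
{ intro t; unfold negpow; rewrite Rpower_Ropp; reflexivity. }
split.
- intros [[h1 [h2 h3]] [pu [posu heq]]]. split; [|assumption].
  exists (Derive u), (Derive_n u 2). split; [|split; [|split; [|split]]].
  + intro t; apply Derive_correct, h1.
  + intro t; apply (Derive_correct (Derive u)), h2.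
  + exact h3.
  + assumption.
  + intro t; rewrite <- epw; apply heq.
- intros [[du [ddu [h1 [h2 [h3 [pu heq]]]]]] posu].
  assert (e1 : Derive u = du) by (apply functional_extensionality; intro; apply is_derive_unique, h1).
  assert (e2 : Derive_n u 2 = ddu).
  { apply functional_extensionality; intro t. change (Derive (Derive u) t = ddu t).
    rewrite e1; apply is_derive_unique, h2. }
  split; [|split; [assumption|split; [assumption|]]].
  + split; [|split].
    * intro t; exists (du t); apply h1.
    * intro t; change (ex_derive (Derive u) t); rewrite e1; exists (ddu t); apply h2.
    * rewrite e2; exact h3.
  + intro t; rewrite e1, e2, epw; apply heq.
Qed.

Lemma average_integral (T xi : R) (u : R -> R) : 0 < T ->
  average T u = xi <-> integral u 0 T = T * xi.
Proof.
intro hT. change (average T u) with (/ T * integral u 0 T). split.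
- intros <-; field; lra.
- intros ->; field; lra.
Qed.

Lemma forced_C0 (T c b mu : R) (gamma e u : R -> R) :
  forced_solution T c b mu gamma e u -> C0 u.
Proof. intros [du [ddu [h _]]]; exact (C0_derivable _ _ h). Qed.

Lemma negpow_monotone (p x y : R) : 0 < p -> 0 < x -> 0 < y -> (negpow p x - negpow p y) * (x - y) <= 0.
Proof.
intros hp hx hy. destruct (Rle_dec x y) as [h|h].
- pose proof (negpow_decr_le p x y hp hx h). nra.
- pose proof (negpow_decr_le p y x hp hy ltac:(lra)). nra.
Qed.

(** The nonlinear terms contribute int a (u1^(-p) - u2^(-p)) (u1 - u2) <= 0 to the energy
    estimate of the mean-zero difference, forcing its derivative to vanish. *)
Lemma solution_unique (T lam p c b : R) (a e u1 u2 : R -> R) (mu1 mu2 : R) :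
  0 < T -> 0 < lam -> lam * T < 2 * PI -> 0 < p -> 0 < b < lam * lam ->
  C0 a -> (forall t, 0 < a t) -> C0 e ->
  positive_periodic_solution T p c b a e mu1 u1 ->
  positive_periodic_solution T p c b a e mu2 u2 ->
  average T u1 = average T u2 -> u1 = u2 /\ mu1 = mu2.
Proof.
intros hT hlam hlT hp hb ca ha ce s1 s2 eav.
apply positive_solution_iff in s1, s2. destruct s1 as [s1 pos1], s2 as [s2 pos2].
pose proof (forced_C0 _ _ _ _ _ _ _ s1) as cu1; pose proof (forced_C0 _ _ _ _ _ _ _ s2) as cu2.
pose proof (C0_negpow p u1 cu1 pos1) as cg1; pose proof (C0_negpow p u2 cu2 pos2) as cg2.
destruct s1 as [H1 [D1 [d1 [dd1 [cD1 [pu1 heq1]]]]]], s2 as [H2 [D2 [d2 [dd2 [cD2 [pu2 heq2]]]]]].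
assert (mW : integral (fun t => u1 t - u2 t) 0 T = 0).
{ apply (average_integral T (average T u2)) in eav; [|assumption].
  rewrite int_minus, eav by assumption.
  rewrite (proj1 (average_integral T (average T u2) u2 hT) eq_refl). ring. }
assert (dW : forall t, is_derive (fun t => u1 t - u2 t) t (H1 t - H2 t)) by (intro; der).
assert (ddW : forall t, is_derive (fun t => H1 t - H2 t) t (D1 t - D2 t)) by (intro; der).
pose proof (C0_derivable _ _ ddW) as cH.
set (I := integral (fun t => (H1 t - H2 t) * (H1 t - H2 t)) 0 T).
assert (h1 : (1 - b / (lam * lam)) * I
   <= integral (fun t => (a t * negpow p (u1 t) - a t * negpow p (u2 t)) * (u1 t - u2 t)) 0 T).
{ apply (energy_coercive T lam c b (mu1 - mu2) (fun t => u1 t - u2 t) (fun t => H1 t - H2 t)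
    (fun t => D1 t - D2 t) (fun t => a t * negpow p (u1 t) - a t * negpow p (u2 t)));
    try assumption; try lra; try c0; try per.
  intro t; specialize (heq1 t); specialize (heq2 t); lra. }
assert (h2 : integral (fun t => (a t * negpow p (u1 t) - a t * negpow p (u2 t)) * (u1 t - u2 t)) 0 T <= 0).
{ replace 0 with (integral (fun _ => 0) 0 T) at 2 by (rewrite int_const; ring).
  apply int_le; [lra|c0|c0|]. intro t.
  pose proof (negpow_monotone p (u1 t) (u2 t) hp (pos1 t) (pos2 t)). specialize (ha t). nra. }
assert (hm : 0 < 1 - b / (lam * lam)).
{ assert (b / (lam * lam) < 1); [|lra].
  apply (Rmult_lt_reg_r (lam * lam)); [nra|]. unfold Rdiv; rewrite Rmult_assoc, Rinv_l by nra. lra. }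
assert (hI : I <= 0) by nra.
assert (eu : u1 = u2).
{ apply functional_extensionality; intro t.
  pose proof (sup_bound T lam (fun t => u1 t - u2 t) (fun t => H1 t - H2 t) t hT hlam hlT dW cH
    ltac:(per) mW) as h; cbv beta in h; fold I in h.
  assert (0 < / (lam * lam)) by (apply Rinv_0_lt_compat; nra).
  apply Rminus_diag_uniq, Rsqr_0_uniq, Rle_antisym; [unfold Rsqr; nra|apply Rle_0_sqr]. }
split; [assumption|]. subst u2.
assert (eH : H1 0 = H2 0) by (rewrite <- (is_derive_unique _ _ _ (d1 0)); apply is_derive_unique, d2).
assert (eD : D1 0 = D2 0).
{ rewrite <- (is_derive_unique _ _ _ (dd1 0)).
  rewrite (Derive_ext H1 H2).
  - apply is_derive_unique, dd2.
  - intro t; rewrite <- (is_derive_unique _ _ _ (d1 t)); apply is_derive_unique, d2. }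
specialize (heq1 0); specialize (heq2 0). rewrite eH, eD in heq1. lra.
Qed.

(** The freezing level d is chosen so that a minimum of u below d would contradict
    [apriori]; the solution of the frozen problem then stays above d and solves the true
    one. *)
Lemma solution_exists (T lam p c b xi : R) (a e : R -> R) :
  0 < T -> 0 < lam -> lam * T < 2 * PI -> 0 < p -> 0 < b < lam * lam ->
  C0 a -> periodic T a -> (forall t, 0 < a t) ->
  C0 e -> periodic T e -> integral e 0 T = 0 -> 0 < xi ->
  exists mu u, positive_periodic_solution T p c b a e mu u /\ average T u = xi.
Proof.
intros hT hlam hlT hp hb ca pa ha ce pe me hxi.
destruct (periodic_min T a hT ca pa) as [s0 hs0].
destruct (periodic_max T a hT ca pa) as [s1 hs1].
destruct (periodic_max T (fun t => Rabs (e t)) hT) as [s2 hs2]; [c0|per|].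
set (amin := a s0) in *. set (A := a s1) in *. set (E := Rabs (e s2)) in *. cbv beta in hs2.
assert (hamin : 0 < amin) by apply ha.
destruct (apriori T lam c b amin A E a e hT hlam hlT hb ca hamin (fun t => conj (hs0 t) (hs1 t)) ce hs2)
  as [S [hS hap]].
set (N := A * negpow p xi + E).
destruct (negpow_blowup p ((N + E + 2 * b * S * N) / amin) hp) as [d0 [hd0 hbig]].
set (d := Rmin d0 xi).
assert (hd : 0 < d) by (apply Rmin_glb_lt; assumption).
assert (hdx : d <= xi) by apply Rmin_r.
assert (hbig' : N + E + 2 * b * S * N < amin * negpow p d).
{ apply Rlt_le_trans with (amin * negpow p d0).
  - apply (Rmult_lt_compat_l amin) in hbig; [|assumption].
    replace (amin * ((N + E + 2 * b * S * N) / amin)) with (N + E + 2 * b * S * N) in hbig by (field; lra).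
    assumption.
  - apply Rmult_le_compat_l; [lra|]. apply negpow_decr_le; [assumption|assumption|apply Rmin_l]. }
destruct (lipschitz_existence T lam c b (- dnegpow p d) A xi a e (truncated p d)) as [mu [u [hsol hmean]]];
  try assumption.
- pose proof (dnegpow_neg p d hp); lra.
- intro t; specialize (ha t); split; [lra|apply hs1].
- intros; apply truncated_lipschitz; assumption.
- intros; apply truncated_decr; assumption.
- pose proof (forced_C0 _ _ _ _ _ _ _ hsol) as cu.
  assert (ch : C0 (fun t => truncated p d (u t))).
  { apply (C0_comp u (truncated p d)); [assumption|].
    apply (lipschitz_C0 _ (- dnegpow p d)); [pose proof (dnegpow_neg p d hp); lra|].
    intros; apply truncated_lipschitz; assumption. }
  assert (etx : truncated p d xi = negpow p xi) by (unfold truncated; rewrite Rmax_left by lra; reflexivity).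
  destruct (hap xi (negpow p xi) mu u (fun t => truncated p d (u t))) as [b1 [b2 [s [hs b3]]]];
    try assumption.
  + left; apply negpow_pos.
  + intro t; left; apply negpow_pos.
  + intros t ht; rewrite <- etx; apply truncated_decr; assumption.
  + intros t ht; rewrite <- etx; apply truncated_decr; assumption.
  + fold N in b1, b2. specialize (b1 s). apply Rabs_le_between in b1.
    assert (hus : d <= u s).
    { apply Rnot_lt_le; intro hlt. unfold truncated in b3. rewrite Rmax_right in b3 by lra. nra. }
    assert (hu : forall t, d <= u t) by (intro t; specialize (hs t); lra).
    exists mu, u. split.
    * apply positive_solution_iff. split; [|intro t; specialize (hu t); lra].
      destruct hsol as [H [D [q1 [q2 [q3 [q4 q5]]]]]].
      exists H, D. split; [assumption|]. split; [assumption|]. split; [assumption|].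
      split; [assumption|]. intro t; rewrite <- q5. unfold truncated.
      rewrite Rmax_left by apply hu. reflexivity.
    * apply average_integral; assumption.
Qed.

(** The first two bounds give the growth of mu at infinity and at 0; the third makes mu
    locally bounded, as needed for its continuity. *)
Lemma solution_mu_bounds (T lam p c b : R) (a e : R -> R) :
  0 < T -> 0 < lam -> lam * T < 2 * PI -> 0 < p -> 0 < b < lam * lam ->
  C0 a -> periodic T a -> (forall t, 0 < a t) ->
  C0 e -> periodic T e -> integral e 0 T = 0 ->
  exists amin E k1 k2, 0 < amin /\ 0 <= k1 /\ 0 <= k2 /\
  forall xi mu u, 0 < xi ->
    positive_periodic_solution T p c b a e mu u -> average T u = xi ->
    b * xi < mu /\ amin * negpow p xi <= mu + E /\ mu <= b * xi + k1 * negpow p xi + k2.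
Proof.
intros hT hlam hlT hp hb ca pa ha ce pe me.
destruct (periodic_min T a hT ca pa) as [s0 hs0].
destruct (periodic_max T a hT ca pa) as [s1 hs1].
destruct (periodic_max T (fun t => Rabs (e t)) hT) as [s2 hs2]; [c0|per|].
set (amin := a s0) in *. set (A := a s1) in *. set (E := Rabs (e s2)) in *. cbv beta in hs2.
assert (hamin : 0 < amin) by apply ha. assert (hA : 0 < A) by apply ha.
assert (hE : 0 <= E) by apply Rabs_pos.
destruct (apriori T lam c b amin A E a e hT hlam hlT hb ca hamin (fun t => conj (hs0 t) (hs1 t)) ce hs2)
  as [S [hS hap]].
assert (hbS : 0 <= b * S) by nra.
exists amin, E, ((b * S + 1) * A), ((b * S + 1) * E).
split; [assumption|]. split; [nra|]. split; [nra|].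
intros xi mu u hxi hsol hav.
apply positive_solution_iff in hsol. destruct hsol as [hsol pos].
apply average_integral in hav; [|assumption].
pose proof (forced_C0 _ _ _ _ _ _ _ hsol) as cu.
pose proof (C0_negpow p u cu pos) as ch.
pose proof (negpow_pos p xi) as hpx.
destruct (hap xi (negpow p xi) mu u (fun t => negpow p (u t))) as [b1 [b2 [s [hs b3]]]]; try assumption.
- lra.
- intro t; left; apply negpow_pos.
- intros t ht; apply negpow_decr_le; auto.
- intros t ht; apply negpow_decr_le; auto.
- split; [|split].
  + pose proof (forced_mean T c b mu xi _ e u hT (C0_mult _ _ ca ch) ce me hsol hav) as hm.
    assert (0 < integral (fun t => a t * negpow p (u t)) 0 T).
    { apply RInt_gt_0; [assumption| |].
      - intros; apply Rmult_lt_0_compat; [apply ha|apply negpow_pos].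
      - intros t _; apply (C0_mult _ _ ca ch). }
    nra.
  + assert (hus : u s <= xi).
    { destruct (mean_zero_vanishes T (fun t => u t - xi) hT) as [z hz]; [c0| |].
      - rewrite int_minus, int_const, hav by c0; ring.
      - specialize (hs z); lra. }
    pose proof (negpow_decr_le p (u s) xi hp (pos s) hus). pose proof (pos s). nra.
  + lra.
Qed.

(** * At most two solutions for each value of mu *)

Lemma derive_exp_linear (k t : R) : is_derive (fun s => exp (k * s)) t (k * exp (k * t)).
Proof. auto_derive; [exact I|ring]. Qed.

(** Gronwall: with E = W^2 + W'^2 one has E' <= kap E, so E exp (- kap t) is nonincreasing
    and stays 0 after s; periodicity covers the times before s. *)
Lemma double_zero (T b c K s : R) (W H D Delta : R -> R) :
  0 < T -> 0 < b -> 0 <= K ->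
  (forall t, is_derive W t (H t)) -> (forall t, is_derive H t (D t)) -> periodic T W ->
  (forall t, D t + c * H t + b * W t + Delta t = 0) ->
  (forall t, Rabs (Delta t) <= K * Rabs (W t)) ->
  W s = 0 -> H s = 0 -> forall t, W t = 0.
Proof.
intros hT hb hK hW hH pW heq hD Ws Hs.
set (kap := 1 + b + K + 2 * Rabs c).
set (X := fun t => exp (- kap * t)).
assert (hX : forall t, is_derive X t (- kap * X t)) by (intro; apply derive_exp_linear).
assert (Xpos : forall t, 0 < X t) by (intro; apply exp_pos).
assert (right : forall t, s <= t -> W t = 0).
{ intros t hst.
  set (F := fun t => - (X t * (W t * W t + H t * H t))).
  set (F' := fun t => X t * (kap * (W t * W t + H t * H t) - 2 * (W t * H t) - 2 * (H t * D t))).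
  assert (h : F s <= F t).
  { apply (increasing_of_derive F F'); [assumption| |].
    - intros r _; unfold F, F'; der.
    - intros r _; unfold F'. apply Rmult_le_pos; [left; apply Xpos|].
      replace (D r) with (- c * H r - b * W r - Delta r) by (specialize (heq r); lra).
      specialize (hD r).
      assert (h1 : Rabs (H r * Delta r) <= K * ((W r * W r + H r * H r) / 2)).
      { rewrite Rabs_mult.
        pose proof (Rsqr_abs (W r)) as a1; pose proof (Rsqr_abs (H r)) as a2; unfold Rsqr in a1, a2.
        rewrite a1, a2. set (x := Rabs (W r)) in *; set (y := Rabs (H r)) in *.
        assert (0 <= x) by apply Rabs_pos. assert (0 <= y) by apply Rabs_pos.
        apply Rle_trans with (y * (K * x)); [apply Rmult_le_compat_l; assumption|].
        pose proof (Rle_0_sqr (x - y)) as h; unfold Rsqr in h.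
        replace (y * (K * x)) with (K * (x * y)) by ring.
        apply Rmult_le_compat_l; [assumption|]. lra. }
      pose proof (Rle_abs c) as h2. pose proof (Rle_abs (- c)) as h3. rewrite Rabs_Ropp in h3.
      apply Rabs_le_between in h1.
      assert (h4 : 0 <= (Rabs c + c) * (H r * H r)) by (apply Rmult_le_pos; [lra|apply Rle_0_sqr]).
      assert (h5 : 0 <= Rabs c * (W r * W r)) by (apply Rmult_le_pos; [apply Rabs_pos|apply Rle_0_sqr]).
      pose proof (Rle_0_sqr (W r - H r)) as h6; pose proof (Rle_0_sqr (W r + H r)) as h7.
      unfold Rsqr in h6, h7. unfold kap. 
      assert (0 <= b * ((W r + H r) * (W r + H r))) by (apply Rmult_le_pos; lra).
      assert (0 <= Rabs c * (H r * H r)) by (apply Rmult_le_pos; [apply Rabs_pos|apply Rle_0_sqr]).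
      lra. }
  unfold F in h. rewrite Ws, Hs in h. specialize (Xpos t).
  assert (X t * (W t * W t + H t * H t) <= 0) by lra.
  pose proof (Rle_0_sqr (H t)) as h1; unfold Rsqr in h1.
  apply Rsqr_0_uniq, Rle_antisym; [unfold Rsqr; nra|apply Rle_0_sqr]. }
intro t. destruct (periodic_reduce T (t - s) hT) as [n [r [hr e]]].
replace t with ((s + r) + IZR n * T) by lra. rewrite periodic_Z by assumption. apply right; lra.
Qed.

(** On an interval shorter than PI / lam the energy identity gives
    int W'^2 <= b int W^2, against the Dirichlet inequality, so W vanishes identically there
    and any point where the mean value theorem applies is a double zero. *)
Lemma short_nodal (lam b c x y : R) (W H D Delta : R -> R) :
  0 < lam -> 0 < b < lam * lam -> x < y -> lam * (y - x) < PI ->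
  (forall t, is_derive W t (H t)) -> (forall t, is_derive H t (D t)) ->
  C0 Delta -> (forall t, D t + c * H t + b * W t + Delta t = 0) ->
  (forall t, Delta t * W t <= 0) -> W x = 0 -> W y = 0 ->
  exists z, W z = 0 /\ H z = 0.
Proof.
intros hlam hb hxy hlen hW hH cD heq hD Wx Wy.
pose proof (C0_derivable _ _ hW) as cW. pose proof (C0_derivable _ _ hH) as cH.
assert (h1 : integral (fun t => (1 * (H t * H t) + -b * (W t * W t)) + -1 * (Delta t * W t)) x y = 0).
{ rewrite (int_derive (fun t => W t * H t + c / 2 * (W t * W t))); [rewrite Wx, Wy; ring| |c0].
  intro t; der. replace (D t) with (- c * H t - b * W t - Delta t) by (specialize (heq t); lra).
  field. }
rewrite int_plus, int_lin, int_scal in h1 by c0.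
assert (h2 : integral (fun t => Delta t * W t) x y <= 0).
{ replace 0 with (integral (fun _ => 0) x y) by (rewrite int_const; ring).
  apply int_le; [lra|c0|c0|assumption]. }
pose proof (dirichlet_inequality lam x y W H hlam (Rlt_le _ _ hxy) hlen hW cH Wx Wy) as h3.
assert (h4 : 0 <= integral (fun t => W t * W t) x y) by (apply int_ge0; [lra|c0|intro; apply Rle_0_sqr]).
set (I := integral (fun t => W t * W t) x y) in *.
assert (hI : I = 0) by nra.
assert (hI' : integral (fun t => H t * H t) x y <= 0) by (rewrite hI in *; lra).
assert (W0 : forall t, x <= t <= y -> W t = 0).
{ intros t ht.
  set (q := fun t => W t * W t + H t * H t).
  assert (cq : C0 q) by (unfold q; c0).
  assert (q0 : forall t, 0 <= q t).
  { intro r; unfold q. pose proof (Rle_0_sqr (W r)); pose proof (Rle_0_sqr (H r)). unfold Rsqr in *; lra. }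
  assert (k1 : W t * W t <= integral q x t).
  { replace (W t * W t) with (integral (fun t => 2 * (W t * H t)) x t).
    - apply int_le; [lra|c0|c0|]. intro r; unfold q.
      pose proof (Rle_0_sqr (W r - H r)) as h; unfold Rsqr in h; lra.
    - rewrite (int_derive (fun t => W t * W t)); [rewrite Wx; ring| |c0]. intro r; der. }
  pose proof (int_chasles q x t y cq) as k2.
  assert (k3 : 0 <= integral q t y) by (apply int_ge0; [lra|assumption|assumption]).
  assert (k4 : integral q x y = I + integral (fun t => H t * H t) x y)
    by (unfold q, I; apply int_plus; c0).
  apply Rsqr_0_uniq, Rle_antisym; [unfold Rsqr; lra|apply Rle_0_sqr]. }
destruct (MVT_cor2 W H x y hxy) as [z [e hz]]; [intros; apply is_derive_Reals, hW|].
exists z; split; [apply W0; lra|]. rewrite Wx, Wy in e. nra.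
Qed.

(** If W vanishes at s without changing sign, s is a double zero.  If it changes sign, it
    vanishes again inside (s, s + T), and one of the two resulting nodal intervals has
    length at most T/2. *)
Lemma sign_trichotomy (T lam b c K : R) (W H D Delta : R -> R) :
  0 < T -> 0 < lam -> lam * T < 2 * PI -> 0 < b < lam * lam -> 0 <= K ->
  (forall t, is_derive W t (H t)) -> (forall t, is_derive H t (D t)) -> periodic T W ->
  C0 Delta -> (forall t, D t + c * H t + b * W t + Delta t = 0) ->
  (forall t, Delta t * W t <= 0) -> (forall t, Rabs (Delta t) <= K * Rabs (W t)) ->
  (forall t, W t = 0) \/ (forall t, 0 < W t) \/ (forall t, W t < 0).
Proof.
intros hT hlam hlT hb hK hW hH pW cD heq hD hDK.
pose proof (C0_derivable _ _ hW) as cW.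
assert (ivt : forall x y, W x < 0 -> 0 < W y -> exists z, Rmin x y <= z <= Rmax x y /\ W z = 0).
{ intros x y hx hy. destruct (IVT_gen W x y 0) as [z hz].
  - apply C0_continuity, cW.
  - rewrite Rmin_left, Rmax_right by lra; lra.
  - exists z; exact hz. }
assert (dz : forall s, W s = 0 -> H s = 0 -> forall t, W t = 0).
{ intros s h1 h2; apply (double_zero T b c K s W H D Delta); try assumption; lra. }
destruct (classic (exists s, W s = 0)) as [[s Ws]|hno].
- left.
  destruct (classic (forall t, 0 <= W t)) as [hge|hnge].
  { apply (dz s Ws). assert (- H s = 0); [|lra].
    apply (derive_at_max (fun t => - W t) (fun t => - H t)); [intro; der|].
    intro r; rewrite Ws; specialize (hge r); lra. }
  destruct (classic (forall t, W t <= 0)) as [hle|hnle].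
  { apply (dz s Ws). apply (derive_at_max W H s hW). intro r; rewrite Ws; apply hle. }
  apply not_all_ex_not in hnge, hnle. destruct hnge as [n hn], hnle as [p hp].
  assert (rep : forall r, exists r', s <= r' <= s + T /\ W r' = W r).
  { intro r; destruct (periodic_reduce T (r - s) hT) as [j [q [hq e]]].
    exists (s + q); split; [lra|]. replace r with ((s + q) + IZR j * T) by lra.
    rewrite periodic_Z by assumption; reflexivity. }
  destruct (rep n) as [n' [hn' en]], (rep p) as [p' [hp' ep]].
  destruct (ivt n' p') as [z [hz Wz]]; [lra|lra|].
  assert (WsT : W (s + T) = 0) by (rewrite pW; assumption).
  assert (zb : s < z < s + T).
  { assert (z <> n') by (intro; subst z; lra). assert (z <> p') by (intro; subst z; lra).
    unfold Rmin, Rmax in hz; destruct (Rle_dec n' p'); lra. }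
  destruct (Rle_dec (z - s) (T / 2)) as [hhalf|hhalf].
  + destruct (short_nodal lam b c s z W H D Delta) as [x [x1 x2]]; try assumption; try lra.
    * nra.
    * exact (dz x x1 x2).
  + destruct (short_nodal lam b c z (s + T) W H D Delta) as [x [x1 x2]]; try assumption; try lra.
    * nra.
    * exact (dz x x1 x2).
- right. destruct (Rtotal_order (W 0) 0) as [h0|[h0|h0]].
  + right; intro t. destruct (Rtotal_order (W t) 0) as [h|[h|h]]; [assumption| |].
    * exfalso; apply hno; exists t; assumption.
    * destruct (ivt 0 t h0 h) as [z [_ hz]]. exfalso; apply hno; exists z; assumption.
  + exfalso; apply hno; exists 0; assumption.
  + left; intro t. destruct (Rtotal_order (W t) 0) as [h|[h|h]]; [| |assumption].
    * destruct (ivt t 0 h h0) as [z [_ hz]]. exfalso; apply hno; exists z; assumption.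
    * exfalso; apply hno; exists t; assumption.
Qed.

(** The difference of the solutions has constant sign, and its average decides which. *)
Lemma solutions_ordered (T lam p c b mu : R) (a e u v : R -> R) :
  0 < T -> 0 < lam -> lam * T < 2 * PI -> 0 < p -> 0 < b < lam * lam ->
  C0 a -> periodic T a -> (forall t, 0 < a t) ->
  positive_periodic_solution T p c b a e mu u ->
  positive_periodic_solution T p c b a e mu v ->
  average T u < average T v -> forall t, u t < v t.
Proof.
intros hT hlam hlT hp hb ca pa ha su sv hav.
apply positive_solution_iff in su, sv. destruct su as [su posu], sv as [sv posv].
pose proof (forced_C0 _ _ _ _ _ _ _ su) as cu; pose proof (forced_C0 _ _ _ _ _ _ _ sv) as cv.
pose proof (C0_negpow p u cu posu) as cgu; pose proof (C0_negpow p v cv posv) as cgv.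
destruct su as [Hu [Du [du [ddu [cDu [pu hequ]]]]]], sv as [Hv [Dv [dv [ddv [cDv [pv heqv]]]]]].
destruct (periodic_min T u hT cu pu) as [su hsu], (periodic_min T v hT cv pv) as [sv hsv].
destruct (periodic_max T a hT ca pa) as [sa hsa].
set (d := Rmin (u su) (v sv)).
assert (hd : 0 < d) by (apply Rmin_glb_lt; [apply posu|apply posv]).
assert (hdu : forall t, d <= u t) by (intro t; eapply Rle_trans; [apply Rmin_l|apply hsu]).
assert (hdv : forall t, d <= v t) by (intro t; eapply Rle_trans; [apply Rmin_r|apply hsv]).
pose proof (dnegpow_neg p d hp) as hdn. pose proof (ha sa) as hA.
assert (hint : integral u 0 T < integral v 0 T).
{ rewrite (proj1 (average_integral T _ u hT) eq_refl), (proj1 (average_integral T _ v hT) eq_refl).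
  apply Rmult_lt_compat_l; assumption. }
destruct (sign_trichotomy T lam b c (a sa * - dnegpow p d) (fun t => v t - u t) (fun t => Hv t - Hu t)
  (fun t => Dv t - Du t) (fun t => a t * negpow p (v t) - a t * negpow p (u t))) as [h|[h|h]];
  try assumption.
- nra.
- intro; der.
- intro; der.
- per.
- c0.
- intro t; specialize (hequ t); specialize (heqv t); lra.
- intro t. pose proof (negpow_monotone p (v t) (u t) hp (posv t) (posu t)). specialize (ha t). nra.
- intro t. rewrite <- Rmult_minus_distr_l, Rabs_mult, (Rabs_pos_eq (a t)) by (left; apply ha).
  rewrite Rmult_assoc. apply Rmult_le_compat; [left; apply ha|apply Rabs_pos|apply hsa|].
  apply negpow_lipschitz; auto.
- exfalso. rewrite (int_ext v u) in hint by (intro t; specialize (h t); cbv beta in h; lra). lra.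
- intro t; specialize (h t); cbv beta in h; lra.
- exfalso. assert (integral v 0 T <= integral u 0 T); [|lra].
  apply int_le; [lra|assumption|assumption|]. intro t; specialize (h t); cbv beta in h; lra.
Qed.

(** With w1 = u2 - u1 and w2 = u3 - u2, the derivative of e^(ct) (w1' w2 - w1 w2') is
    e^(ct) a times the convexity defect of x^(-p) at u1 < u2 < u3, hence positive.  At a
    maximum s of the periodic quotient w1 / w2 the Wronskian vanishes, and by periodicity
    it vanishes at s + T as well; this works for either sign of c. *)
Lemma at_most_two_solutions (T lam p c b mu : R) (a e u1 u2 u3 : R -> R) :
  0 < T -> 0 < lam -> lam * T < 2 * PI -> 0 < p -> 0 < b < lam * lam ->
  C0 a -> periodic T a -> (forall t, 0 < a t) ->
  positive_periodic_solution T p c b a e mu u1 ->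
  positive_periodic_solution T p c b a e mu u2 ->
  positive_periodic_solution T p c b a e mu u3 ->
  average T u1 < average T u2 -> average T u2 < average T u3 -> False.
Proof.
intros hT hlam hlT hp hb ca pa ha s1 s2 s3 hav12 hav23.
pose proof (solutions_ordered T lam p c b mu a e u1 u2 hT hlam hlT hp hb ca pa ha s1 s2 hav12) as o12.
pose proof (solutions_ordered T lam p c b mu a e u2 u3 hT hlam hlT hp hb ca pa ha s2 s3 hav23) as o23.
apply positive_solution_iff in s1, s2, s3.
destruct s1 as [[H1 [D1 [d1 [dd1 [cD1 [p1 heq1]]]]]] pos1].
destruct s2 as [[H2 [D2 [d2 [dd2 [cD2 [p2 heq2]]]]]] pos2].
destruct s3 as [[H3 [D3 [d3 [dd3 [cD3 [p3 heq3]]]]]] pos3].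
pose proof (C0_derivable _ _ d1) as cu1. pose proof (C0_derivable _ _ d2) as cu2.
pose proof (C0_derivable _ _ d3) as cu3.
pose proof (per_derive _ _ _ d1 p1) as pH1. pose proof (per_derive _ _ _ d2 p2) as pH2.
pose proof (per_derive _ _ _ d3 p3) as pH3.
(* The maximum k of the quotient is used through w1 - k w2 <= 0, with equality at s, which
   avoids differentiating the quotient. *)
assert (hmax : exists s k, forall t, (u2 t - u1 t) - k * (u3 t - u2 t) <= 0 /\
   (u2 s - u1 s) - k * (u3 s - u2 s) = 0).
{ destruct (periodic_max T (fun t => (u2 t - u1 t) * / (u3 t - u2 t)) hT) as [s hs].
  - apply C0_mult; [c0|]. intro t.
    apply (ex_derive_continuous (fun x => / (u3 x - u2 x))).
    apply (ex_derive_inv (fun x => u3 x - u2 x)).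
    + exists (H3 t - H2 t); der.
    + apply Rgt_not_eq; specialize (o23 t); lra.
  - intro t; rewrite p1, p2, p3; reflexivity.
  - exists s, ((u2 s - u1 s) * / (u3 s - u2 s)). intro t; split.
    + specialize (hs t); cbv beta in hs. specialize (o23 t).
      assert (eq : u2 t - u1 t = (u2 t - u1 t) * / (u3 t - u2 t) * (u3 t - u2 t)) by (field; lra).
      rewrite eq at 1. nra.
    + specialize (o23 s); field; lra. }
destruct hmax as [s [k hk]].
assert (hder : (H2 s - H1 s) - k * (H3 s - H2 s) = 0).
{ apply (derive_at_max (fun t => (u2 t - u1 t) - k * (u3 t - u2 t))
    (fun t => (H2 t - H1 t) - k * (H3 t - H2 t))).
  - intro; der.
  - intro t. rewrite (proj2 (hk s)). apply hk. }
pose proof (proj2 (hk s)) as hval.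
set (X := fun t => exp (c * t)).
assert (hX : forall t, is_derive X t (c * X t)) by (intro; apply derive_exp_linear).
set (Z := fun t => X t * ((H2 t - H1 t) * (u3 t - u2 t) - (u2 t - u1 t) * (H3 t - H2 t))).
set (Z' := fun t => X t * (a t * ((negpow p (u3 t) - negpow p (u2 t)) * (u2 t - u1 t)
                                 - (negpow p (u2 t) - negpow p (u1 t)) * (u3 t - u2 t)))).
assert (dZ : forall t, is_derive Z t (Z' t)).
{ intro t. unfold Z, Z'. der.
  specialize (heq1 t); specialize (heq2 t); specialize (heq3 t).
  replace (D1 t) with (mu + e t - c * H1 t - b * u1 t - a t * negpow p (u1 t)) by lra.
  replace (D2 t) with (mu + e t - c * H2 t - b * u2 t - a t * negpow p (u2 t)) by lra.
  replace (D3 t) with (mu + e t - c * H3 t - b * u3 t - a t * negpow p (u3 t)) by lra.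
  ring. }
assert (Z0 : Z s = 0).
{ unfold Z. replace (H2 s - H1 s) with (k * (H3 s - H2 s)) by lra.
  replace (u2 s - u1 s) with (k * (u3 s - u2 s)) by lra. ring. }
assert (Z1 : Z (s + T) = 0).
{ unfold Z; rewrite pH1, pH2, pH3, p1, p2, p3.
  replace (H2 s - H1 s) with (k * (H3 s - H2 s)) by lra.
  replace (u2 s - u1 s) with (k * (u3 s - u2 s)) by lra. ring. }
destruct (MVT_cor2 Z Z' s (s + T)) as [z [ez hz]]; [lra|intros; apply is_derive_Reals, dZ|].
rewrite Z0, Z1 in ez.
assert (0 < Z' z); [|nra].
unfold Z'. apply Rmult_lt_0_compat; [apply exp_pos|]. apply Rmult_lt_0_compat; [apply ha|].
pose proof (negpow_convex p (u1 z) (u2 z) (u3 z) hp (pos1 z) (o12 z) (o23 z)). lra.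
Qed.

(** * The solution curve *)

(** For two solutions with averages xi and xi0, the mean-zero part of their difference
    satisfies an energy estimate whose right side is at most |xi - xi0| times the integral of
    the difference of the nonlinear terms, and that integral is T times the change of
    mu - b xi, which is locally bounded.  Hence the solutions are uniformly close, and
    integrating the equation shows the same for mu. *)
Lemma mu_continuous (T lam p c b xi0 mu0 : R) (a e u0 : R -> R) :
  0 < T -> 0 < lam -> lam * T < 2 * PI -> 0 < p -> 0 < b < lam * lam ->
  C0 a -> periodic T a -> (forall t, 0 < a t) ->
  C0 e -> periodic T e -> integral e 0 T = 0 -> 0 < xi0 ->
  positive_periodic_solution T p c b a e mu0 u0 -> average T u0 = xi0 ->
  forall eps, 0 < eps -> exists delta, 0 < delta /\ forall xi mu u, 0 < xi ->
    Rabs (xi - xi0) < delta ->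
    positive_periodic_solution T p c b a e mu u -> average T u = xi ->
    Rabs (mu - mu0) < eps.
Proof.
intros hT hlam hlT hp hb ca pa ha ce pe me hxi0 s0 av0 eps heps.
destruct (solution_mu_bounds T lam p c b a e hT hlam hlT hp hb ca pa ha ce pe me)
  as [amin [E [k1 [k2 [hamin [hk1 [hk2 hbd]]]]]]].
set (M := b * (2 * xi0) + k1 * negpow p (xi0 / 2) + k2).
set (L := / (lam * lam)).
assert (hL : 0 < L) by (apply Rinv_0_lt_compat; nra).
set (m := 1 - b / (lam * lam)).
assert (hm : 0 < m).
{ unfold m. assert (b / (lam * lam) < 1); [|lra].
  apply (Rmult_lt_reg_r (lam * lam)); [nra|]. unfold Rdiv; rewrite Rmult_assoc, Rinv_l by nra. lra. }
assert (hM : forall xi mu u, xi0 / 2 < xi < 2 * xi0 ->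
  positive_periodic_solution T p c b a e mu u -> average T u = xi -> 0 <= mu - b * xi <= M).
{ intros xi mu u hxi s av. destruct (hbd xi mu u ltac:(lra) s av) as [h1 [_ h2]].
  pose proof (negpow_decr_le p (xi0 / 2) xi hp ltac:(lra) ltac:(lra)) as h3.
  assert (k1 * negpow p xi <= k1 * negpow p (xi0 / 2)) by (apply Rmult_le_compat_l; assumption).
  assert (0 < b * xi) by nra. assert (b * xi <= b * (2 * xi0)) by nra. unfold M. lra. }
pose proof (hM xi0 mu0 u0 ltac:(lra) s0 av0) as hM0.
apply positive_solution_iff in s0. destruct s0 as [s0 pos0].
pose proof (forced_C0 _ _ _ _ _ _ _ s0) as cu0.
pose proof (C0_negpow p u0 cu0 pos0) as cg0.
apply average_integral in av0; [|assumption].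
pose proof (forced_mean T c b mu0 xi0 _ e u0 hT (C0_mult _ _ ca cg0) ce me s0 av0) as mean0.
destruct s0 as [H0 [D0 [d0 [dd0 [cD0 [pu0 heq0]]]]]].
destruct (periodic_min T u0 hT cu0 pu0) as [sm hsm].
destruct (periodic_max T a hT ca pa) as [sa hsa].
set (A := a sa) in *. assert (hA : 0 < A) by apply ha.
set (d := u0 sm) in *. assert (hd : 0 < d) by apply pos0.
set (K := - dnegpow p (d / 2)). assert (hK : 0 < K) by (pose proof (dnegpow_neg p (d / 2) hp); unfold K; lra).
assert (hAK : 0 < A * K) by nra.
set (Q := (1 + L) * (T * M / m)).
assert (hM' : 0 <= M) by lra.
assert (hQ : 0 <= Q).
{ unfold Q, Rdiv. assert (0 < / m) by (apply Rinv_0_lt_compat; assumption).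
  repeat apply Rmult_le_pos; lra. }
(* If u and u0 differ by at most sig, then u >= d / 2, where x^(-p) is K-Lipschitz, and the
   change of mu is at most (b + A K) sig. *)
set (sig := Rmin (d / 2) (eps / (2 * (b + A * K)))).
assert (hsig : 0 < sig) by (apply Rmin_glb_lt; [lra|apply Rdiv_lt_0_compat; lra]).
assert (hsig1 : sig <= d / 2) by apply Rmin_l.
assert (hsig2 : (b + A * K) * sig <= eps / 2).
{ apply Rle_trans with ((b + A * K) * (eps / (2 * (b + A * K)))); [|right; field; lra].
  apply Rmult_le_compat_l; [lra|apply Rmin_r]. }
set (del := Rmin (xi0 / 2) (Rmin (sig / 2) (sig * sig / (4 * (Q + 1))))).
assert (hdel : 0 < del).
{ repeat apply Rmin_glb_lt; try lra. apply Rdiv_lt_0_compat; nra. }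
exists del; split; [assumption|]. intros xi mu u hxi hdist s av.
assert (hd1 : Rabs (xi - xi0) < xi0 / 2) by (eapply Rlt_le_trans; [exact hdist|apply Rmin_l]).
assert (hd2 : Rabs (xi - xi0) < sig / 2).
{ eapply Rlt_le_trans; [exact hdist|]. eapply Rle_trans; [apply Rmin_r|apply Rmin_l]. }
assert (hd3 : Rabs (xi - xi0) < sig * sig / (4 * (Q + 1))).
{ eapply Rlt_le_trans; [exact hdist|]. eapply Rle_trans; [apply Rmin_r|apply Rmin_r]. }
set (eta := Rabs (xi - xi0)) in *.
assert (heta : 0 <= eta) by apply Rabs_pos.
assert (hd4 : Q * eta <= (sig / 2) * (sig / 2)).
{ apply Rle_trans with ((Q + 1) * (sig * sig / (4 * (Q + 1)))); [|right; field; lra].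
  apply Rmult_le_compat; lra. }
apply Rabs_lt_between in hd1.
pose proof (hM xi mu u ltac:(lra) s av) as hM1.
apply positive_solution_iff in s. destruct s as [s pos].
pose proof (forced_C0 _ _ _ _ _ _ _ s) as cu.
pose proof (C0_negpow p u cu pos) as cg.
apply average_integral in av; [|assumption].
pose proof (forced_mean T c b mu xi _ e u hT (C0_mult _ _ ca cg) ce me s av) as mean.
destruct s as [H [D [d1 [dd1 [cD [pu heq]]]]]].
set (Delta := fun t => a t * negpow p (u t) - a t * negpow p (u0 t)).
assert (cDelta : C0 Delta) by (unfold Delta; c0).
assert (iDelta : integral Delta 0 T = T * ((mu - b * xi) - (mu0 - b * xi0))).
{ unfold Delta. rewrite int_minus, mean, mean0 by c0. ring. }
set (W := fun t => (u t - u0 t) - (xi - xi0)).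
assert (cW : C0 W) by (unfold W; c0).
assert (dW : forall t, is_derive W t (H t - H0 t)) by (intro; unfold W; der).
assert (ddW : forall t, is_derive (fun t => H t - H0 t) t (D t - D0 t)) by (intro; der).
pose proof (C0_derivable _ _ ddW) as cH.
assert (pW : periodic T W) by (unfold W; per).
assert (mW : integral W 0 T = 0).
{ unfold W. rewrite !int_minus, !int_const, av, av0 by c0. ring. }
set (I := integral (fun t => (H t - H0 t) * (H t - H0 t)) 0 T).
assert (h1 : m * I <= integral (fun t => Delta t * W t) 0 T).
{ apply (energy_coercive T lam c b (mu - mu0 - b * (xi - xi0)) W (fun t => H t - H0 t)
    (fun t => D t - D0 t) Delta); try assumption; try lra.
  intro t; specialize (heq t); specialize (heq0 t); unfold Delta, W; lra. }
assert (h2 : integral (fun t => Delta t * W t) 0 T <= eta * (T * M)).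
{ apply Rle_trans with (integral (fun t => - (xi - xi0) * Delta t) 0 T).
  - apply int_le; [lra|c0|c0|]. intro t; unfold W, Delta.
    pose proof (negpow_monotone p (u t) (u0 t) hp (pos t) (pos0 t)). specialize (ha t). nra.
  - rewrite int_scal, iDelta by assumption.
    eapply Rle_trans; [apply Rle_abs|]. rewrite Rabs_mult, Rabs_Ropp. fold eta.
    apply Rmult_le_compat_l; [assumption|].
    rewrite Rabs_mult, (Rabs_pos_eq T) by lra. apply Rmult_le_compat_l; [lra|].
    apply Rabs_le_between; lra. }
assert (h3 : I <= T * M / m * eta).
{ apply (Rmult_le_reg_l m); [assumption|].
  replace (m * (T * M / m * eta)) with (eta * (T * M)) by (field; lra). lra. }
assert (hW : forall t, Rabs (W t) <= sig / 2).
{ intro t.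
  pose proof (sup_bound T lam W (fun t => H t - H0 t) t hT hlam hlT dW cH pW mW) as h.
  cbv beta in h. fold I L in h.
  assert (W t * W t <= (sig / 2) * (sig / 2)).
  { eapply Rle_trans; [exact h|]. eapply Rle_trans; [|exact hd4].
    unfold Q. rewrite Rmult_assoc. apply Rmult_le_compat_l; lra. }
  rewrite <- (Rabs_pos_eq (sig / 2)) by lra. apply Rsqr_le_abs_0. assumption. }
assert (hu : forall t, Rabs (u t - u0 t) <= sig).
{ intro t. specialize (hW t). unfold W in hW. apply Rabs_lt_between in hd2.
  apply Rabs_le_between in hW. apply Rabs_le_between. lra. }
assert (hDelta : forall t, Rabs (Delta t) <= A * K * sig).
{ intro t. unfold Delta. rewrite <- Rmult_minus_distr_l, Rabs_mult, (Rabs_pos_eq (a t)) by (left; apply ha).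
  rewrite Rmult_assoc. apply Rmult_le_compat; [left; apply ha|apply Rabs_pos|apply hsa|].
  eapply Rle_trans; [apply (negpow_lipschitz p (d / 2)); try lra|].
  - specialize (hu t); specialize (hsm t). apply Rabs_le_between in hu. fold d in hsm. lra.
  - specialize (hsm t); fold d in hsm; lra.
  - apply Rmult_le_compat_l; [fold K; lra|apply hu]. }
assert (hmu : Rabs ((mu - b * xi) - (mu0 - b * xi0)) <= A * K * sig).
{ apply (Rmult_le_reg_l T); [assumption|].
  rewrite <- (Rabs_pos_eq T) at 1 by lra. rewrite <- Rabs_mult, <- iDelta.
  eapply Rle_trans; [apply (abs_RInt_le_const Delta 0 T (A * K * sig))|]; try lra.
  - apply C0_ex_RInt; assumption.
  - intros; apply hDelta. }
apply Rabs_le_between in hmu. apply Rabs_lt_between in hd2. apply Rabs_lt_between.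
assert (b * (xi - xi0) <= b * sig) by nra. assert (- (b * sig) <= b * (xi - xi0)) by nra. lra.
Qed.

(** * Coercive functions taking each value at most twice *)

Lemma ivt_open (phi : R -> R) (x y v : R) : 0 < x -> x < y ->
  (forall z, 0 < z -> continuous phi z) ->
  phi x < v < phi y \/ phi y < v < phi x -> exists z, x < z < y /\ phi z = v.
Proof.
intros hx hxy hc hv.
assert (main : forall f : R -> R, (forall z, 0 < z -> continuous f z) -> f x < 0 -> 0 < f y ->
  exists z, x < z < y /\ f z = 0).
{ intros f hf h1 h2. destruct (IVT_interv f x y) as [z [hz e]]; try assumption.
  - intros z hz; apply continuity_pt_filterlim, hf; lra.
  - exists z; split; [|assumption].
    assert (z <> x) by (intro; subst z; lra). assert (z <> y) by (intro; subst z; lra). lra. }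
destruct hv as [hv|hv].
- destruct (main (fun z => phi z - v)) as [z [hz e]]; try lra.
  + intros z hz. apply (continuous_minus phi (fun _ => v)); [apply hc, hz|apply continuous_const].
  + exists z; split; [assumption|lra].
- destruct (main (fun z => v - phi z)) as [z [hz e]]; try lra.
  + intros z hz. apply (continuous_minus (fun _ => v) phi); [apply continuous_const|apply hc, hz].
  + exists z; split; [assumption|lra].
Qed.

Definition blows_up_at_0 (phi : R -> R) : Prop :=
  forall M, exists d, 0 < d /\ forall x, 0 < x -> x <= d -> M < phi x.

Definition blows_up_at_infinity (phi : R -> R) : Prop :=
  forall M, exists N, forall x, N <= x -> M < phi x.

Lemma attained_left (phi : R -> R) (y v : R) :
  (forall z, 0 < z -> continuous phi z) -> blows_up_at_0 phi ->
  0 < y -> phi y < v -> exists z, 0 < z < y /\ phi z = v.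
Proof.
intros hc h0 hy hv. destruct (h0 v) as [d [hd hdv]].
set (x := Rmin d (y / 2)).
assert (hx : 0 < x) by (apply Rmin_glb_lt; lra).
assert (x <= y / 2) by apply Rmin_r.
destruct (ivt_open phi x y v hx ltac:(lra) hc) as [z [hz e]].
- right; split; [assumption|]. apply hdv; [assumption|apply Rmin_l].
- exists z; split; [lra|assumption].
Qed.

Lemma attained_right (phi : R -> R) (x v : R) :
  (forall z, 0 < z -> continuous phi z) -> blows_up_at_infinity phi ->
  0 < x -> phi x < v -> exists z, x < z /\ phi z = v.
Proof.
intros hc hi hx hv. destruct (hi v) as [N hN].
set (y := Rmax N (x + 1)).
assert (x + 1 <= y) by apply Rmax_r.
destruct (ivt_open phi x y v hx ltac:(lra) hc) as [z [hz e]].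
- left; split; [assumption|]. apply hN, Rmax_l.
- exists z; split; [lra|assumption].
Qed.

Lemma coercive_min (phi : R -> R) :
  (forall z, 0 < z -> continuous phi z) -> blows_up_at_0 phi -> blows_up_at_infinity phi ->
  exists x0, 0 < x0 /\ forall x, 0 < x -> phi x0 <= phi x.
Proof.
intros hc h0 hi.
destruct (h0 (phi 1)) as [d [hd hdv]], (hi (phi 1)) as [N hN].
set (x := Rmin d 1). set (y := Rmax N 1).
assert (hx : 0 < x) by (apply Rmin_glb_lt; lra).
assert (hx1 : x <= 1) by apply Rmin_r. assert (hy1 : 1 <= y) by apply Rmax_r.
destruct (continuity_ab_min phi x y) as [s [hs hsr]]; [lra| |].
- intros z hz; apply continuity_pt_filterlim, hc; lra.
- exists s; split; [lra|]. intros z hz. pose proof (hs 1 ltac:(lra)) as h1.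
  destruct (Rle_dec x z) as [hxz|hxz].
  + destruct (Rle_dec z y) as [hzy|hzy]; [apply hs; lra|].
    pose proof (hN z); pose proof (Rmax_l N 1) as h2; fold y in h2. specialize (hN z ltac:(lra)). lra.
  + pose proof (Rmin_l d 1) as h2; fold x in h2. specialize (hdv z hz ltac:(lra)). lra.
Qed.

(** If phi were not strictly monotone on one side of a minimum point, some level would be
    attained twice on that side and a third time on the other side, where phi also goes to
    infinity.  Two minimum points are excluded likewise: a level slightly above the minimum
    is attained twice between them and once more to their right. *)
Lemma parabola_like_of_two_to_one (phi : R -> R) :
  (forall z, 0 < z -> continuous phi z) -> blows_up_at_0 phi -> blows_up_at_infinity phi ->
  (forall x y z, 0 < x -> x < y -> y < z -> phi x = phi y -> phi y = phi z -> False) ->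
  parabola_like 0 phi.
Proof.
intros hc h0 hi h3. split; [exact hc|].
destruct (coercive_min phi hc h0 hi) as [x0 [hx0 hmin]].
assert (two_minima : forall x y, 0 < x -> x < y -> phi x = phi x0 -> phi y = phi x0 -> False).
{ intros x y hx hxy ex ey.
  set (z := (x + y) / 2). assert (hz : x < z < y) by (unfold z; lra).
  destruct (hmin z ltac:(lra)) as [h|h].
  - set (v := (phi x0 + phi z) / 2). assert (hv : phi x0 < v < phi z) by (unfold v; lra).
    destruct (ivt_open phi x z v ltac:(lra) ltac:(lra) hc ltac:(left; lra)) as [z1 [g1 e1]].
    destruct (ivt_open phi z y v ltac:(lra) ltac:(lra) hc ltac:(right; lra)) as [z2 [g2 e2]].
    destruct (attained_right phi y v hc hi ltac:(lra) ltac:(lra)) as [z3 [g3 e3]].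
    apply (h3 z1 z2 z3); lra.
  - apply (h3 x z y); lra. }
exists x0. split; [assumption|]. split; [|split; [|exact hmin]].
- intros x y hx hxy hy. apply Rnot_le_lt; intro hle.
  destruct hy as [hy| ->].
  + assert (hym : phi x0 < phi y).
    { destruct (hmin y ltac:(lra)) as [h|h]; [assumption|].
      exfalso; apply (two_minima y x0); lra. }
    destruct hle as [hlt|heq].
    * set (v := (phi x + phi y) / 2). assert (hv : phi x < v < phi y) by (unfold v; lra).
      pose proof (hmin x hx).
      destruct (ivt_open phi x y v ltac:(lra) ltac:(lra) hc ltac:(left; lra)) as [z1 [g1 e1]].
      destruct (ivt_open phi y x0 v ltac:(lra) ltac:(lra) hc ltac:(right; lra)) as [z2 [g2 e2]].
      destruct (attained_right phi x0 v hc hi ltac:(lra) ltac:(lra)) as [z3 [g3 e3]].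
      apply (h3 z1 z2 z3); lra.
    * destruct (attained_right phi x0 (phi y) hc hi ltac:(lra) ltac:(lra)) as [z3 [g3 e3]].
      apply (h3 x y z3); lra.
  + pose proof (hmin x hx). apply (two_minima x x0); lra.
- intros x y hx hxy. apply Rnot_le_lt; intro hle.
  destruct hx as [hx| <-].
  + assert (hxm : phi x0 < phi x).
    { destruct (hmin x ltac:(lra)) as [h|h]; [assumption|].
      exfalso; apply (two_minima x0 x); lra. }
    destruct hle as [hlt|heq].
    * set (v := (phi x + phi y) / 2). assert (hv : phi y < v < phi x) by (unfold v; lra).
      pose proof (hmin y ltac:(lra)).
      destruct (attained_left phi x0 v hc h0 ltac:(lra) ltac:(lra)) as [z1 [g1 e1]].
      destruct (ivt_open phi x0 x v ltac:(lra) ltac:(lra) hc ltac:(left; lra)) as [z2 [g2 e2]].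
      destruct (ivt_open phi x y v ltac:(lra) ltac:(lra) hc ltac:(right; lra)) as [z3 [g3 e3]].
      apply (h3 z1 z2 z3); lra.
    * destruct (attained_left phi x0 (phi x) hc h0 ltac:(lra) ltac:(lra)) as [z1 [g1 e1]].
      apply (h3 z1 x y); lra.
  + pose proof (hmin y ltac:(lra)). apply (two_minima x0 y); lra.
Qed.

Lemma average_pos (T p c b mu : R) (a e u : R -> R) : 0 < T ->
  positive_periodic_solution T p c b a e mu u -> 0 < average T u.
Proof.
intros hT s. apply positive_solution_iff in s. destruct s as [s pos].
pose proof (forced_C0 _ _ _ _ _ _ _ s) as cu.
apply Rmult_lt_0_compat; [apply Rinv_0_lt_compat; assumption|].
apply RInt_gt_0; [assumption|intros; apply pos|intros t _; apply cu].
Qed.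

(** Existence provides phi by choice; uniqueness makes its graph the whole solution set. *)
Lemma solution_curve (T lam p c b : R) (a e : R -> R) :
  0 < T -> 0 < lam -> lam * T < 2 * PI -> 0 < p -> 0 < b < lam * lam ->
  C0 a -> periodic T a -> (forall t, 0 < a t) ->
  C0 e -> periodic T e -> integral e 0 T = 0 ->
  exists phi : R -> R,
    (forall xi mu, (exists u, positive_periodic_solution T p c b a e mu u /\ average T u = xi)
       <-> 0 < xi /\ mu = phi xi) /\
    (forall xi, 0 < xi -> 0 < phi xi) /\
    (forall xi, 0 < xi -> continuous phi xi) /\
    blows_up_at_0 phi /\ blows_up_at_infinity phi /\ parabola_like 0 phi.
Proof.
intros hT hlam hlT hp hb ca pa ha ce pe me.
destruct (functional_choice (fun xi mu => 0 < xi ->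
  exists u, positive_periodic_solution T p c b a e mu u /\ average T u = xi)) as [phi hphi].
{ intro xi. destruct (Rlt_dec 0 xi) as [h|h]; [|exists 0; intro; contradiction].
  destruct (solution_exists T lam p c b xi a e hT hlam hlT hp hb ca pa ha ce pe me h) as [mu [u hu]].
  exists mu; intros _; exists u; exact hu. }
destruct (solution_mu_bounds T lam p c b a e hT hlam hlT hp hb ca pa ha ce pe me)
  as [amin [E [k1 [k2 [hamin [hk1 [hk2 hbd]]]]]]].
assert (curve : forall xi mu, (exists u, positive_periodic_solution T p c b a e mu u /\ average T u = xi)
       <-> 0 < xi /\ mu = phi xi).
{ intros xi mu; split.
  - intros [u [s av]]. assert (hxi : 0 < xi) by (rewrite <- av; apply (average_pos T p c b mu a e u hT s)).
    split; [assumption|]. destruct (hphi xi hxi) as [v [sv avv]].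
    apply (solution_unique T lam p c b a e u v mu (phi xi)); try assumption. congruence.
  - intros [hxi ->]. apply hphi, hxi. }
assert (bounds : forall xi, 0 < xi -> b * xi < phi xi /\ amin * negpow p xi <= phi xi + E).
{ intros xi hxi. destruct (hphi xi hxi) as [u [s av]].
  destruct (hbd xi (phi xi) u hxi s av) as [h1 [h2 _]]. split; assumption. }
assert (cont : forall xi, 0 < xi -> continuous phi xi).
{ intros xi hxi. destruct (hphi xi hxi) as [u [s av]].
  apply continuity_pt_filterlim. intros eps heps.
  destruct (mu_continuous T lam p c b xi (phi xi) a e u hT hlam hlT hp hb ca pa ha ce pe me hxi s av eps heps)
    as [d [hd hcont]].
  exists (Rmin d xi); split; [apply Rmin_glb_lt; assumption|].
  intros x [_ hx]. unfold dist in *; simpl in *; unfold R_dist in *.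
  assert (h1 : Rabs (x - xi) < d) by (eapply Rlt_le_trans; [exact hx|apply Rmin_l]).
  assert (h2 : Rabs (x - xi) < xi) by (eapply Rlt_le_trans; [exact hx|apply Rmin_r]).
  apply Rabs_lt_between in h2.
  destruct (hphi x ltac:(lra)) as [v [sv avv]].
  apply (hcont x (phi x) v); try assumption. lra. }
assert (b0 : blows_up_at_0 phi).
{ intro M. destruct (negpow_blowup p ((M + E) / amin) hp) as [d [hd hpd]].
  exists d; split; [assumption|]. intros x hx hxd. destruct (bounds x hx) as [_ h].
  pose proof (negpow_decr_le p x d hp hx hxd).
  apply (Rmult_lt_compat_l amin) in hpd; [|assumption].
  replace (amin * ((M + E) / amin)) with (M + E) in hpd by (field; lra). nra. }
assert (bi : blows_up_at_infinity phi).
{ intro M. exists (Rmax 1 (M / b)). intros x hx.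
  pose proof (Rmax_l 1 (M / b)); pose proof (Rmax_r 1 (M / b)).
  destruct (bounds x ltac:(lra)) as [h _].
  assert (M = b * (M / b)) by (field; lra). nra. }
exists phi. split; [exact curve|]. split; [intros xi hxi; destruct (bounds xi hxi); nra|].
split; [exact cont|]. split; [exact b0|]. split; [exact bi|].
apply parabola_like_of_two_to_one; try assumption.
intros x y z hx hxy hyz e1 e2.
destruct (hphi x ltac:(lra)) as [u1 [s1 a1]], (hphi y ltac:(lra)) as [u2 [s2 a2]],
  (hphi z ltac:(lra)) as [u3 [s3 a3]].
rewrite <- e2 in s3. rewrite e1 in s1.
apply (at_most_two_solutions T lam p c b (phi y) a e u1 u2 u3); try assumption; lra.
Qed.

(** The Wirtinger inequality is only available below omega, so a spare frequency between
    sqrt b and omega is fixed once and for all. *)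
Lemma frequency_gap (T omega b : R) : 0 < T -> omega = 2 * PI / T -> 0 < b < omega ^ 2 ->
  exists lam, 0 < lam /\ lam * T < 2 * PI /\ b < lam * lam.
Proof.
intros hT ho hb.
assert (hopos : 0 < omega) by (rewrite ho; apply Rdiv_lt_0_compat; [pose proof PI_RGT_0|]; lra).
assert (hs : sqrt b < omega).
{ rewrite <- (sqrt_pow2 omega) by lra. apply sqrt_lt_1_alt; lra. }
pose proof (sqrt_lt_R0 b ltac:(lra)) as hs0. pose proof (sqrt_sqrt b ltac:(lra)) as hss.
exists ((sqrt b + omega) / 2). split; [lra|]. split.
- assert (omega * T = 2 * PI) by (rewrite ho; field; lra). nra.
- nra.
Qed.

Theorem theorem5p1
  (T omega p c b : R) (a e : R -> R)
  (hT : 0 < T) (homega : omega = 2 * PI / T) (hp : 0 < p)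
  (hb : 0 < b < omega ^ 2)
  (ha_cont : forall t, continuous a t) (ha_per : periodic T a)
  (ha_pos : forall t, 0 < a t)
  (he_cont : forall t, continuous e t) (he_per : periodic T e)
  (he_mean : RInt e 0 T = 0) :
  (exists mu0 : R, 0 < mu0 /\
    forall mu : R,
      (mu0 < mu -> exactly_two (positive_periodic_solution T p c b a e mu)) /\
      (mu = mu0 -> exactly_one (positive_periodic_solution T p c b a e mu)) /\
      (mu < mu0 -> none (positive_periodic_solution T p c b a e mu)))
  /\
  (forall (u1 u2 : R -> R) (mu1 mu2 : R),
      positive_periodic_solution T p c b a e mu1 u1 ->
      positive_periodic_solution T p c b a e mu2 u2 ->
      average T u1 = average T u2 ->
      u1 = u2 /\ mu1 = mu2)
  /\
  (exists (xibar : R) (phi : R -> R),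
      parabola_like_solution_curve T p c b a e xibar phi /\
      (forall (xibar' : R) (phi' : R -> R),
          parabola_like_solution_curve T p c b a e xibar' phi' ->
          xibar' = xibar /\ forall xi, xibar < xi -> phi' xi = phi xi) /\
      filterlim phi (at_right xibar) (Rbar_locally p_infty) /\
      is_lim phi p_infty p_infty /\
      ((exists a0 : R, forall t, a t = a0) -> xibar = 0)).
Proof.
destruct (frequency_gap T omega b hT homega hb) as [lam [hlam [hlT hblam]]].
assert (hb' : 0 < b < lam * lam) by lra.
destruct (solution_curve T lam p c b a e hT hlam hlT hp hb' ha_cont ha_per ha_pos he_cont he_per he_mean)
  as [phi [curve [phi_pos [cont [b0 [bi hpar]]]]]].
assert (uniq : forall (u1 u2 : R -> R) (mu1 mu2 : R),
      positive_periodic_solution T p c b a e mu1 u1 ->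
      positive_periodic_solution T p c b a e mu2 u2 ->
      average T u1 = average T u2 -> u1 = u2 /\ mu1 = mu2).
{ intros u1 u2 mu1 mu2 s1 s2 av.
  apply (solution_unique T lam p c b a e u1 u2 mu1 mu2); assumption. }
assert (onc : forall mu u, positive_periodic_solution T p c b a e mu u ->
  0 < average T u /\ mu = phi (average T u)).
{ intros mu u s; apply curve; exists u; split; [assumption|reflexivity]. }
split; [|split; [exact uniq|]].
- destruct hpar as [_ [x0 [hx0 [hdec [hinc hmin]]]]].
  exists (phi x0). split; [apply phi_pos, hx0|]. intro mu. split; [|split].
  + intro hmu.
    destruct (attained_left phi x0 mu cont b0 hx0 hmu) as [x1 [hx1 e1]].
    destruct (attained_right phi x0 mu cont bi hx0 hmu) as [x2 [hx2 e2]].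
    destruct (proj2 (curve x1 mu)) as [u1 [s1 a1]]; [split; [lra|congruence]|].
    destruct (proj2 (curve x2 mu)) as [u2 [s2 a2]]; [split; [lra|congruence]|].
    exists u1, u2. split; [intros ->; lra|]. intro v; split.
    * intro sv. destruct (onc mu v sv) as [hx ev]. set (x := average T v) in *.
      destruct (Rle_dec x x0) as [h|h].
      -- left. apply (uniq v u1 mu mu sv s1). rewrite a1. fold x.
         destruct (Rtotal_order x x1) as [g|[g|g]]; [|assumption|].
         ++ pose proof (hdec x x1 hx g ltac:(lra)); lra.
         ++ pose proof (hdec x1 x ltac:(lra) g h); lra.
      -- right. apply (uniq v u2 mu mu sv s2). rewrite a2. fold x.
         destruct (Rtotal_order x x2) as [g|[g|g]]; [|assumption|].
         ++ pose proof (hinc x x2 ltac:(lra) g); lra.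
         ++ pose proof (hinc x2 x ltac:(lra) g); lra.
    * intros [-> | ->]; assumption.
  + intros ->. destruct (proj2 (curve x0 (phi x0))) as [u [s av]]; [split; [assumption|reflexivity]|].
    exists u; split; [assumption|]. intros v sv. destruct (onc _ v sv) as [hx ev].
    apply (uniq u v (phi x0) (phi x0) s sv). rewrite av.
    destruct (Rtotal_order x0 (average T v)) as [g|[g|g]]; [|assumption|].
    * pose proof (hinc x0 _ (Rle_refl x0) g); lra.
    * pose proof (hdec _ x0 hx g (Rle_refl x0)); lra.
  + intros hmu v sv. destruct (onc mu v sv) as [hx ev]. pose proof (hmin _ hx). lra.
- exists 0, phi. split; [|split; [|split; [|split]]].
  + split; [apply Rle_refl|]. split; assumption.
  + intros xibar' phi' [hx' [_ curve']].
    assert (same : forall xi, 0 < xi -> xibar' < xi /\ phi' xi = phi xi).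
    { intros xi hxi. destruct (proj1 (curve' xi (phi xi))) as [h1 h2].
      - apply curve; split; [assumption|reflexivity].
      - split; [assumption|symmetry; assumption]. }
    split; [|intros xi hxi; apply same, hxi].
    apply Rle_antisym; [|assumption]. apply Rnot_lt_le; intro h.
    destruct (same xibar' h); lra.
  + intros P [M hM]. destruct (b0 M) as [d [hd hdv]].
    exists (mkposreal d hd). intros x hx hx0. apply hM, hdv; [assumption|].
    change (Rabs (x - 0) < d) in hx. apply Rabs_lt_between in hx. lra.
  + intros P [M hM]. destruct (bi M) as [N hN]. exists N. intros x hx. apply hM, hN. lra.
  + reflexivity.
Qed.
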